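(* Let $L>0$ and $\omega>0$ be fixed and let $\alpha>0$ be a fixed even integer. Let $\varphi$ be an odd (hence sign-changing) $L$-periodic real solution (with minimal period $L$) of $$-\varphi''+\omega\varphi-|\varphi|^\alpha\varphi=0$$ obtained from the minimization problem $$\inf\left\{\mathcal{B}_\omega(u):=\frac12\int_0^L |u_x|^2+\omega|u|^2\,dx \;:\; u\in\mathbb{H}^1_{per,odd},\ \int_0^L|u|^{\alpha+2}\,dx=\upsilon\right\}$$ for some $\upsilon>0$ (in the sense made precise in the context). Then there exist $\lambda>0$, $\kappa>0$ and ${\rm w}\in\mathbb{H}^2_{per}$, ${\rm w}\neq0$, such that $$\mathcal{S}(\kappa){\rm w}=\lambda J{\rm w}.$$ In other words, the odd periodic standing wave $\varphi$ is transversally unstable.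
   Context: Functions on the torus $\mathbb{T}_L$ are identified with $L$-periodic functions on $\mathbb{R}$. $H^s_{per}=H^s(\mathbb{T}_L)$ is the Sobolev space of real-valued $L$-periodic functions, $L^2_{per}=H^0_{per}$, $\mathbb{H}^s_{per}=H^s_{per}\times H^s_{per}$, $\mathbb{L}^2_{per}=L^2_{per}\times L^2_{per}$; a complex-valued function $f=f_1+if_2$ is identified with the pair $(f_1,f_2)$, and $|u|$ is the complex modulus. $\mathbb{H}^1_{per,odd}$ is the subspace of $\mathbb{H}^1_{per}$ of odd functions. The phrase ''$\varphi$ is obtained from the minimization problem'' means: $\varphi$ is the real function such that, for some $\theta_1\in\mathbb{R}$, $\Psi=e^{i\theta_1}\varphi$ is a minimizer of the problem for some $\upsilon>0$ (equivalently $\upsilon=\int_0^L|\varphi|^{\alpha+2}dx$), normalized by scaling so that the Lagrange multiplier is $1$, i.e. so that $-\Psi''+\omega\Psi-|\Psi|^\alpha\Psi=0$. Operators with domain $H^2_{per}\subset L^2_{per}$: $$\mathcal{L}_1=-\partial_x^2+\omega-(\alpha+1)|\varphi|^\alpha,\qquad \mathcal{L}_2=-\partial_x^2+\omega-|\varphi|^\alpha .$$ Set $J=\begin{pmatrix}0&-1\\1&0\end{pmatrix}$ and, for $\kappa\in\mathbb{R}$, the operator on $\mathbb{L}^2_{per}$ with domain $\mathbb{H}^2_{per}$ $$\mathcal{S}(\kappa)=J^{-1}\begin{pmatrix}\mathcal{L}_1+\kappa^2&0\\0&\mathcal{L}_2+\kappa^2\end{pmatrix}J=\begin{pmatrix}\mathcal{L}_2+\kappa^2&0\\0&\mathcal{L}_1+\kappa^2\end{pmatrix}.$$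 These arise from linearizing $iu_t+\Delta u+|u|^\alpha u=0$ on $\mathbb{T}_L\times\mathbb{R}$ about the standing wave $e^{i\omega t}\varphi(x)$ with perturbations of the form $e^{\lambda t}\cos(\kappa y){\rm v}(x)$. The wave $\varphi$ is called transversally unstable if for some $\kappa>0$ there are $\lambda\in\mathbb{C}$ with ${\rm Re}(\lambda)>0$ and $U\neq0$ (in the complexification of $\mathbb{H}^2_{per}$) with $\mathcal{S}(\kappa)U=\lambda JU$. *)

(* Defs.v *)
From HB Require Import structures.
From mathcomp Require Import all_boot all_order all_algebra.
From mathcomp Require Import all_classical all_reals all_analysis.
From mathcomp Require Import complex.

Set Implicit Arguments.
Unset Strict Implicit.
Unset Printing Implicit Defensive.

Import Order.TTheory GRing.Theory Num.Theory.
Import numFieldNormedType.Exports.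

Local Open Scope ring_scope.
Local Open Scope complex_scope.
Local Open Scope classical_set_scope.

Section periodic_sobolev.
Context {R : realType}.
Notation mu := (@lebesgue_measure R).

(* Elements of L^2(T_L) are represented by L-periodic Borel functions; the
   L^2 equality of two representatives is almost everywhere equality. *)
Definition L2per (L : R) (f : R -> R) : Prop :=
  [/\ periodic f L, measurable_fun setT f &
      mu.-integrable `[0, L] (fun x => (f x ^+ 2)%:E)].

Definition smooth_per (L : R) (psi : R -> R) : Prop :=
  periodic psi L /\ forall n x, derivable psi^`(n) x 1.

Definition weak_deriv (L : R) (f g : R -> R) : Prop :=
  forall psi, smooth_per L psi ->
    \int[mu]_(x in `[0, L]) (f x * derive1 psi x) =
    - \int[mu]_(x in `[0, L]) (g x * psi x).

(* H^m(T_L) for an integer m. An element carries (representatives of) its weak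
   derivatives: [wder 0] is the function itself and [wder i] its i-th weak
   derivative for i <= m; they are determined by [wder 0] up to null sets.
   [wder i] is meaningless for i > m. *)
Record Hper (L : R) (m : nat) := MkHper {
  wder : nat -> R -> R ;
  wder_L2 : forall i, (i <= m)%N -> L2per L (wder i) ;
  wder_weak : forall i, (i < m)%N -> weak_deriv L (wder i) (wder i.+1) }.

Definition Hper_fun L m (u : Hper L m) : R -> R := wder u 0.
Coercion Hper_fun : Hper >-> Funclass.

Definition HHper (L : R) (m : nat) : Type := (Hper L m * Hper L m)%type.

(* A pair (f1, f2) also stands for the complex-valued function f1 + i f2. *)
Definition fpair : Type := ((R -> R) * (R -> R))%type.

Definition pair_of L m (u : HHper L m) : fpair := (u.1 : R -> R, u.2 : R -> R).

Definition pzero : fpair := (cst 0, cst 0).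

Definition pscale (a : R) (f : fpair) : fpair :=
  (fun x => a * f.1 x, fun x => a * f.2 x).

Definition peq_ae (f g : fpair) : Prop :=
  ae_eq mu setT f.1 g.1 /\ ae_eq mu setT f.2 g.2.

Definition cmod (f : fpair) (x : R) : R := Num.sqrt (f.1 x ^+ 2 + f.2 x ^+ 2).

(* e^{i theta} f for a real-valued f *)
Definition phase_rot (theta : R) (f : R -> R) : fpair :=
  (fun x => cos theta * f x, fun x => sin theta * f x).

Definition odd_fun (f : R -> R) : Prop := forall x, f (- x) = - f x.

Definition odd_ae (f : R -> R) : Prop :=
  ae_eq mu setT (fun x => f (- x)) (fun x => - f x).

Definition HHper_odd L m (u : HHper L m) : Prop := odd_ae u.1 /\ odd_ae u.2.

Definition minimal_period (f : R -> R) (L : R) : Prop :=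
  periodic f L /\ forall T, 0 < T -> T < L -> ~ periodic f T.

Definition twice_derivable (f : R -> R) : Prop :=
  forall x, derivable f x 1 /\ derivable f^`() x 1.

End periodic_sobolev.

Arguments fpair : clear implicits.

Section standing_wave.
Context {R : realType}.
Notation mu := (@lebesgue_measure R).
Variables (L omega : R) (alpha : nat).

Definition stationary_real (f : R -> R) : Prop :=
  twice_derivable f /\
  forall x, - derive1n 2 f x + omega * f x - `|f x| ^+ alpha * f x = 0.

Definition stationary_complex (f : fpair R) : Prop :=
  [/\ twice_derivable f.1, twice_derivable f.2,
      forall x, - derive1n 2 f.1 x + omega * f.1 x - cmod f x ^+ alpha * f.1 x = 0 &
      forall x, - derive1n 2 f.2 x + omega * f.2 x - cmod f x ^+ alpha * f.2 x = 0].

Definition B_energy (u : HHper L 1) : R :=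
  2^-1 * \int[mu]_(x in `[0, L])
    (cmod (wder u.1 1, wder u.2 1) x ^+ 2 + omega * cmod (pair_of u) x ^+ 2).

Definition admissible (upsilon : R) (u : HHper L 1) : Prop :=
  HHper_odd u /\
  \int[mu]_(x in `[0, L]) (cmod (pair_of u) x ^+ (alpha + 2)) = upsilon.

Definition is_minimizer (upsilon : R) (u : HHper L 1) : Prop :=
  admissible upsilon u /\
  forall v : HHper L 1, admissible upsilon v -> B_energy u <= B_energy v.

(* The last clause is the normalization of the Lagrange multiplier to 1. *)
Definition obtained_from_minimization (phi : R -> R) : Prop :=
  exists (theta upsilon : R) (Psi : HHper L 1),
    [/\ 0 < upsilon, is_minimizer upsilon Psi,
        peq_ae (pair_of Psi) (phase_rot theta phi) &
        stationary_complex (phase_rot theta phi)].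

Variable phi : R -> R.

Definition L1_op (f : Hper L 2) : R -> R := fun x =>
  - wder f 2 x + omega * f x - (alpha.+1)%:R * `|phi x| ^+ alpha * f x.

Definition L2_op (f : Hper L 2) : R -> R := fun x =>
  - wder f 2 x + omega * f x - `|phi x| ^+ alpha * f x.

Definition J_op (f : fpair R) : fpair R := (fun x => - f.2 x, f.1).

(* J^{-1} diag(L1 + kappa^2, L2 + kappa^2) J, i.e. the diagonal operator with
   the two entries exchanged *)
Definition S_op (kappa : R) (w : HHper L 2) : fpair R :=
  (fun x => L2_op w.1 x + kappa ^+ 2 * w.1 x,
   fun x => L1_op w.2 x + kappa ^+ 2 * w.2 x).

(* S(kappa) U = lambda J U for U = Ur + i Ui in the complexification *)
Definition S_eigen_complex (kappa : R) (lambda : R[i]) (Ur Ui : HHper L 2) :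
    Prop :=
  let SUr := S_op kappa Ur in let SUi := S_op kappa Ui in
  let JUr := J_op (pair_of Ur) in let JUi := J_op (pair_of Ui) in
  ae_eq mu setT (fun x => SUr.1 x +i* SUi.1 x)
                (fun x => lambda * (JUr.1 x +i* JUi.1 x)) /\
  ae_eq mu setT (fun x => SUr.2 x +i* SUi.2 x)
                (fun x => lambda * (JUr.2 x +i* JUi.2 x)).

Definition transversally_unstable : Prop :=
  exists (kappa : R) (lambda : R[i]) (Ur Ui : HHper L 2),
    [/\ 0 < kappa, 0 < complex.Re lambda,
        ~ (peq_ae (pair_of Ur) pzero /\ peq_ae (pair_of Ui) pzero) &
        S_eigen_complex kappa lambda Ur Ui].

End standing_wave.

(* Main.v *)
From HB Require Import structures.
Require Import Defs.
From mathcomp Require Import all_boot all_order all_algebra.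
From mathcomp Require Import all_classical all_reals all_analysis.
From mathcomp Require Import measurable_realfun complex ring lra.

Set Implicit Arguments.
Unset Strict Implicit.
Unset Printing Implicit Defensive.

Import Order.TTheory GRing.Theory Num.Theory.
Import numFieldNormedType.Exports.

Local Open Scope ring_scope.
Local Open Scope classical_set_scope.

(** With p = kappa^2, the equation S(kappa) w = lambda J w is the second order
    system
      w1'' = (omega - phi^alpha + p) w1 + lambda w2,
      w2'' = (omega - (alpha + 1) phi^alpha + p) w2 - lambda w1,
    whose L-periodic solutions are sought with p > 0 and lambda > 0.

    The profile phi is odd, and a phase plane argument shows that, up to sign,
    it increases on [0, m] and is even about m, where m = L / 4
    ([profile_quarter], [profile_slope_gt0]): by conservation of energy and
    uniqueness, any other zero or critical point would lead to a period shorter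
    than L. Consequently a solution of the system on the whole line with
    w(0) = 0 and w'(m) = 0 is odd and even about m, hence L-periodic
    ([coupled_periodic]), and only a boundary value problem on [0, m] is left.

    That problem is solved by shooting ([shooting]). Let d(p, lambda) be the
    determinant of the map sending w'(0) to w'(m) over the solutions with
    w(0) = 0; a boundary value solution exists exactly when d vanishes. At
    lambda = 0 the system decouples and d(p, 0) is the product of the end
    slopes of two scalar solutions, one for L2 + p and one for L1 + p.
    - Comparison with phi, which satisfies L2 phi = 0 and phi' (m) = 0, makes
      the slope for L2 + p positive for every p > 0 ([slope_true_gt0]).
    - Comparison with phi, which satisfies L1 phi = - alpha phi^(alpha+1) < 0,
      makes the slope for L1 negative ([slope_false_lt0]); by continuity so is
      the slope for L1 + p when p > 0 is small ([small_slope_lt0]).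
    - Both slopes are positive when p is so large that both potentials are
      nonnegative ([slope_large_gt0]).
    So d is negative at some (p0, 0) and positive at some (p1, 0). On the arc
    p = p0 + s (p1 - p0), lambda = s (1 - s) with 0 <= s <= 1, it vanishes
    somewhere, necessarily at an interior point, where p > 0 and lambda > 0.

    Both comparisons need the scalar solutions to be positive on (0, m), which
    is a Sturm argument ([sturm_positive]) with phi' as supersolution. The
    solutions themselves come from Picard iteration ([linear_system_solution]),
    and uniqueness and continuity in the parameters from one Gronwall estimate
    ([linear_system_estimate]). *)

(** * Pointwise rules for derivatives *)

Section pointwise_rules.
Context {R : realType}.
Implicit Types (f g : R -> R) (x a b c : R).

Lemma derive_ptC c x : is_derive x 1 (fun=> c) 0.
Proof. exact: is_derive_cst. Qed.

Lemma derive_pt_id x : is_derive x 1 (fun y => y) 1.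
Proof. exact: is_derive_id. Qed.

Lemma derive_ptN f x a :
  is_derive x 1 f a -> is_derive x 1 (fun y => - f y) (- a).
Proof. exact: is_deriveN. Qed.

Lemma derive_ptD f g x a b : is_derive x 1 f a -> is_derive x 1 g b ->
  is_derive x 1 (fun y => f y + g y) (a + b).
Proof. exact: is_deriveD. Qed.

Lemma derive_ptM f g x a b : is_derive x 1 f a -> is_derive x 1 g b ->
  is_derive x 1 (fun y => f y * g y) (f x * b + g x * a).
Proof. exact: is_deriveM. Qed.

Lemma derive_ptX f n x a : is_derive x 1 f a ->
  is_derive x 1 (fun y => f y ^+ n) (n%:R * f x ^+ n.-1 * a).
Proof.
move=> fa; have -> : (fun y => f y ^+ n) = f ^+ n.
  by apply/funext => y; rewrite exprfctE.
exact: is_deriveX.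
Qed.

Lemma derive_pt_expR f x a : is_derive x 1 f a ->
  is_derive x 1 (fun y => expR (f y)) (expR (f x) * a).
Proof. by move=> fa; apply: (@is_derive1_comp _ expR f). Qed.

Lemma derive_pt_comp f g x a b : is_derive x 1 g b -> is_derive (g x) 1 f a ->
  is_derive x 1 (fun y => f (g y)) (a * b).
Proof. by move=> gb fa; apply: (@is_derive1_comp _ f g). Qed.

Lemma derive_ptV f x a : f x != 0 -> is_derive x 1 f a ->
  is_derive x 1 (fun y => (f y)^-1) (- (f x) ^- 2 * a).
Proof. by move=> f0 fa; apply: is_deriveV. Qed.

Lemma derive_pt_sum (I : finType) (h : I -> R -> R) (dh : I -> R) x :
  (forall i, is_derive x 1 (h i) (dh i)) ->
  is_derive x 1 (fun y => \sum_i h i y) (\sum_i dh i).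
Proof.
move=> dh_h; rewrite !unlock; elim: (index_enum I) => [|i s IH] /=.
  exact: derive_ptC.
exact: derive_ptD.
Qed.

Lemma is_derive_continuous f x a :
  is_derive x 1 f a -> {for x, continuous f}.
Proof. by move=> [fa _]; apply/differentiable_continuous/derivable1_diffP. Qed.

End pointwise_rules.

Ltac diff_step :=
  lazymatch goal with
  | |- is_derive _ _ (fun _ => ?c) _ => exact: derive_ptC
  | |- is_derive _ _ (fun y => y) _ => exact: derive_pt_id
  | |- is_derive _ _ (fun y => @?f y + @?g y) _ => eapply (@derive_ptD _ f g)
  | |- is_derive _ _ (fun y => - @?f y) _ => eapply (@derive_ptN _ f)
  | |- is_derive _ _ (fun y => @?f y * @?g y) _ => eapply (@derive_ptM _ f g)
  | |- is_derive _ _ (fun y => @?f y ^+ ?n) _ => eapply (@derive_ptX _ f n)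
  | |- is_derive _ _ (fun y => expR (@?f y)) _ => eapply (@derive_pt_expR _ f)
  end.

(** [diff] differentiates by the shape of the function, using the hypotheses
    of the context at the leaves, and leaves the equation between the value it
    found and the expected one. *)
Ltac diff :=
  eapply is_derive_eq;
  [repeat first [diff_step | solve [eauto 3]
     | lazymatch goal with
       | |- is_derive _ _ (fun y => ?f (@?g y)) _ =>
           eapply (@derive_pt_comp _ f g)
       end]
  | cbv beta].

(** * Inequalities obtained from derivatives *)

Section monotonicity.
Context {R : realType}.
Implicit Types (f df g : R -> R) (a b c K T x : R).

Lemma MVT_derive f df a b : a < b ->
  (forall x, a <= x <= b -> is_derive x 1 f (df x)) ->
  exists2 c, a < c < b & f b - f a = df c * (b - a).
Proof.
move=> ab fD.
have [x xab||c cab fE] := @MVT R f df a b ab; first 1 last.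
- apply: continuous_in_subspaceT => x /set_mem; rewrite /= in_itv/= => xab.
  exact: is_derive_continuous (fD x xab).
- by exists c.
- by move: xab; rewrite in_itv/= => /andP[ax xb]; apply: fD; rewrite !ltW.
Qed.

Lemma derive_ge0_le f df a b : a <= b ->
  (forall x, a <= x <= b -> is_derive x 1 f (df x)) ->
  (forall x, a < x < b -> 0 <= df x) -> f a <= f b.
Proof.
rewrite le_eqVlt => /predU1P[->//|ab] fD df0.
have [c cab fE] := MVT_derive ab fD.
by rewrite -subr_ge0 fE mulr_ge0 ?df0// subr_ge0 ltW.
Qed.

Lemma derive_gt0_lt f df a b : a < b ->
  (forall x, a <= x <= b -> is_derive x 1 f (df x)) ->
  (forall x, a < x < b -> 0 < df x) -> f a < f b.
Proof.
move=> ab fD df0; have [c cab fE] := MVT_derive ab fD.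
by rewrite -subr_gt0 fE mulr_gt0 ?df0// subr_gt0.
Qed.

Lemma derive_eq_sub f g df a b : a <= b ->
  (forall x, a <= x <= b -> is_derive x 1 f (df x)) ->
  (forall x, a <= x <= b -> is_derive x 1 g (df x)) -> f b - f a = g b - g a.
Proof.
rewrite le_eqVlt => /predU1P[->|ab] fD gD; first by rewrite !subrr.
have [|c cab] := @MVT_derive (fun y => f y - g y) (fun=> 0) a b ab.
  move=> x xab; rewrite -(subrr (df x)).
  by apply: derive_ptD; [exact: fD|apply: derive_ptN; exact: gD].
lra.
Qed.

(** Integrating the weight [expR (K * `|x|)] gains a factor [1 / K] uniformly in
    [x]; this makes the Picard map a contraction on the whole line at once. *)
Lemma derive_le_expR_norm f df c K : 0 <= c -> 0 < K ->
  f 0 = 0 -> (forall x, is_derive x 1 f (df x)) ->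
  (forall x : R, `|df x| <= c * K * expR (K * `|x|)) ->
  forall x, `|f x| <= c * expR (K * `|x|).
Proof.
move=> c0 K0.
have half (h dh : R -> R) : h 0 = 0 -> (forall x : R, is_derive x 1 h (dh x)) ->
    (forall x, `|dh x| <= c * K * expR (K * `|x|)) ->
    forall x, 0 <= x -> `|h x| <= c * expR (K * x).
  move=> h0 hD dh_le x x0; rewrite ler_norml; apply/andP; split.
  - have : c * expR (K * 0) + h 0 <= c * expR (K * x) + h x.
      apply: (@derive_ge0_le (fun y => c * expR (K * y) + h y)
        (fun y => c * K * expR (K * y) + dh y) 0 x x0).
      + by move=> y _; diff; ring.
      + move=> y /andP[y0 _]; have := dh_le y.
        by rewrite (gtr0_norm y0) ler_norml => /andP[]; lra.
    by rewrite h0 mulr0 expR0; lra.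
  - have : c * expR (K * 0) - h 0 <= c * expR (K * x) - h x.
      apply: (@derive_ge0_le (fun y => c * expR (K * y) - h y)
        (fun y => c * K * expR (K * y) - dh y) 0 x x0).
      + by move=> y _; diff; ring.
      + move=> y /andP[y0 _]; have := dh_le y.
        by rewrite (gtr0_norm y0) ler_norml => /andP[]; lra.
    by rewrite h0 mulr0 expR0; lra.
move=> f0 fD df_le x; have [x0|x0] := leP 0 x.
  by rewrite (ger0_norm x0); exact: (half f df).
rewrite (ltr0_norm x0) -[x in `|f x|]opprK.
apply: (half (fun y => f (- y)) (fun y => - df (- y))).
- by rewrite oppr0.
- by move=> y; diff; ring.
- by move=> y; rewrite normrN -[`|y|]normrN.
- by rewrite oppr_ge0 ltW.
Qed.

(** The function [c * x - f x * expR (- (K * x))] is nondecreasing. *)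
Lemma gronwall f df K c T : 0 <= K -> 0 <= c -> 0 <= T -> f 0 = 0 ->
  (forall x, 0 <= x <= T -> is_derive x 1 f (df x)) ->
  (forall x, 0 <= x <= T -> df x <= K * f x + c) ->
  f T <= c * T * expR (K * T).
Proof.
move=> K0 c0 T0 f0 fD df_le.
have : c * 0 - f 0 * expR (- (K * 0)) <= c * T - f T * expR (- (K * T)).
  apply: (@derive_ge0_le (fun y => c * y - f y * expR (- (K * y)))
    (fun y => c - (df y - K * f y) * expR (- (K * y))) 0 T T0).
  - by move=> x xT; have := fD x xT => ?; diff; ring.
  - move=> x /andP[x0 xT].
    have e1 : expR (- (K * x)) <= 1.
      by rewrite -expR0 ler_expR oppr_le0 mulr_ge0 // ltW.
    have e0 := expR_ge0 (- (K * x)).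
    have d1 : df x - K * f x <= c.
      by rewrite lerBlDl df_le// !ltW.
    have [d0|d0] := leP 0 (df x - K * f x); first nra.
    nra.
rewrite f0 mul0r subr0 mulr0 expRN subr_ge0.
by rewrite ler_pdivrMr ?expR_gt0.
Qed.

(** The intervals of radius [2 * c * 2^-1 ^+ k] around [v k] are nested; their
    common point is the supremum of the left ends. *)
Lemma geometric_limit (v : nat -> R) c :
  (forall k, `|v k.+1 - v k| <= c * 2^-1 ^+ k) ->
  exists l, forall k, `|v k - l| <= 2 * c * 2^-1 ^+ k.
Proof.
move=> vS.
have c0 : 0 <= c by have := vS 0%N; rewrite expr0 mulr1; exact: le_trans.
pose lo k := v k - 2 * c * 2^-1 ^+ k.
pose hi k := v k + 2 * c * 2^-1 ^+ k.
have step k : lo k <= lo k.+1 /\ hi k.+1 <= hi k.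
  have := vS k; rewrite /lo /hi ler_norml exprS => /andP[]; lra.
have lo_homo : {homo lo : i j / (i <= j)%N >-> i <= j}.
  by apply: homo_leq => [//|x y z|k]; [exact: le_trans|exact: (step k).1].
have hi_homo : {homo hi : i j / (i <= j)%N >-> j <= i}.
  by apply: homo_leq => [//|x y z zy yx|k]; [exact: le_trans yx zy|exact: (step k).2].
have lohi i j : lo i <= hi j.
  have /lo_homo/le_trans : (i <= maxn i j)%N by rewrite leq_maxl.
  apply; have /hi_homo : (j <= maxn i j)%N by rewrite leq_maxr.
  apply: le_trans; have : 0 <= 2^-1 ^+ maxn i j :> R by rewrite exprn_ge0.
  by rewrite /lo /hi; nra.
exists (sup (range lo)) => k.
have lo_sup : has_sup (range lo).
  by split; [exists (lo 0%N); exists 0%N|exists (hi 0%N) => _ [i _ <-]].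
have l1 : lo k <= sup (range lo) by apply: sup_upper_bound => //; exists k.
have l2 : sup (range lo) <= hi k.
  by apply: sup_le_ub => [|_ [i _ <-]//]; case: lo_sup.
by rewrite ler_norml; move: l1 l2; rewrite /lo /hi; lra.
Qed.

Lemma geometric_small_eq0 c (y : R) : (forall k, `|y| <= c * 2^-1 ^+ k) -> y = 0.
Proof.
move=> yk; apply/eqP/negP => /negP; rewrite -normr_gt0 => y0.
have := upper_nthrootP (leqnn (Num.bound (c / `|y|))).
set k := Num.bound _ => ck.
have := yk k; rewrite exprVn ler_pdivlMr ?exprn_gt0//.
by move: ck; rewrite ltr_pdivrMr// => ck; lra.
Qed.
End monotonicity.

(** * Existence for linear systems *)

Section primitive.
Context {R : realType}.
Notation mu := (@lebesgue_measure R).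
Implicit Types (f F : R -> R).

(** The integral from [- N] to [x] is differentiable for [x > - N] only. Up to
    their value at 0 these functions agree for all [N], which allows [N] to
    depend on [x]. *)
Lemma continuous_primitive f : continuous f ->
  exists F, F 0 = 0 /\ forall x : R, is_derive x 1 F (f x).
Proof.
move=> fc.
pose G N (x : R) := \int[mu]_(t in `[- N, x]) f t.
have GD N (x : R) : - N < x -> is_derive x 1 (G N) (f x).
  move=> Nx; have [] := @continuous_FTC1_closed R f (- N) x (x + 1).
  - by rewrite ltrDl.
  - apply: continuous_compact_integrable; first exact: segment_compact.
    exact: continuous_subspaceT.
  - exact: Nx.
  - exact: fc.
  by move=> GD GE; apply: DeriveDef; [exact: GD|rewrite -derive1E; exact: GE].
pose F x := G (`|x| + 1) x - G (`|x| + 1) 0.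
have FE N x : 0 < N -> - N < x -> F x = G N x - G N 0.
  move=> N0 Nx; rewrite /F.
  have M0 : 0 < `|x| + 1 by rewrite ltr_wpDl.
  have Mx : - (`|x| + 1) < x.
    by rewrite ltrNl; apply: le_lt_trans (ler_norm _) _; rewrite normrN ltrDl.
  have [x0|x0] := leP 0 x.
    apply: (@derive_eq_sub _ _ _ f) => // y /andP[y0 _]; apply: GD;
      apply: lt_le_trans y0; by rewrite oppr_lt0.
  apply/oppr_inj; rewrite !opprB.
  by apply: (@derive_eq_sub _ _ _ f) => [|y /andP[xy _]|y /andP[xy _]];
    [exact: ltW|apply: GD; exact: lt_le_trans xy..].
exists F; split; first by rewrite /F subrr.
move=> x; set N := `|x| + 1.
have N0 : 0 < N by rewrite ltr_wpDl.
have Nx : - N < x.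
  by rewrite ltrNl; apply: le_lt_trans (ler_norm _) _; rewrite normrN ltrDl.
apply: (@near_eq_is_derive _ _ _ (fun y => G N y - G N 0)).
  have : \forall y \near x, - N < y by exact: lt_nbhsr.
  by apply: filterS => y Ny; rewrite (FE N).
by have := GD N x Nx => ?; diff; ring.
Qed.

Definition primitive f : R -> R :=
  xget (fun=> 0) [set F | F 0 = 0 /\ forall x : R, is_derive x 1 F (f x)].

Lemma primitive0 f : continuous f -> primitive f 0 = 0.
Proof.
move=> /continuous_primitive[F FE].
by rewrite /primitive; case: xgetP => [G _ []//|/(_ F)].
Qed.

Lemma is_derive_primitive f (x : R) : continuous f ->
  is_derive x 1 (primitive f) (f x).
Proof.
move=> /continuous_primitive[F FE].
by rewrite /primitive; case: xgetP => [G _ []//|/(_ F)].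
Qed.

End primitive.

Section linear_system.
Context {R : realType} (I : finType).
Variables (A : I -> I -> R -> R) (B : R) (a : I -> R).
Hypothesis A_cont : forall i j, continuous (A i j).
Hypothesis B_gt0 : 0 < B.
Hypothesis A_le : forall i x, \sum_j `|A i j x| <= B.

Fixpoint picard (k : nat) : I -> R -> R :=
  if k is k'.+1 then
    fun i x => a i + primitive (fun t => \sum_j A i j t * picard k' j t) x
  else fun i _ => a i.

Lemma continuous_sumM (g : I -> R -> R) i :
  (forall j, continuous (g j)) -> continuous (fun t => \sum_j A i j t * g j t).
Proof.
move=> gc x; rewrite unlock; elim: (index_enum I) => [|j s IH] /=.
  exact: cvg_cst.
by apply: cvgD => //; apply: cvgM; [exact: A_cont|exact: gc].
Qed.

Lemma picard_continuous k i : continuous (picard k i).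
Proof.
elim: k i => [|k IH] i x /=; first exact: cvg_cst.
apply: cvgD; first exact: cvg_cst.
apply: is_derive_continuous.
by apply: is_derive_primitive; exact: continuous_sumM.
Qed.

Lemma picard0 k i : picard k i 0 = a i.
Proof.
case: k => [//|k] /=; rewrite primitive0 ?addr0//.
by apply: continuous_sumM => j; exact: picard_continuous.
Qed.

Lemma picard_derive k i (x : R) :
  is_derive x 1 (picard k.+1 i) (\sum_j A i j x * picard k j x).
Proof.
have cA : continuous (fun t => \sum_j A i j t * picard k j t).
  by apply: continuous_sumM => j; exact: picard_continuous.
have ? := is_derive_primitive x cA.
by rewrite /=; diff; rewrite add0r.
Qed.

Lemma sumM_le (h : I -> R) (c : R) i x : (forall j, `|h j| <= c) ->
  `|\sum_j A i j x * h j| <= B * c.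
Proof.
move=> hc; apply: le_trans (ler_norm_sum _ _ _) _.
have c0 : 0 <= c by have := hc i; exact: le_trans.
apply: (@le_trans _ _ (\sum_j `|A i j x| * c)).
  by apply: ler_sum => j _; rewrite normrM ler_wpM2l.
by rewrite -mulr_suml ler_wpM2r.
Qed.

Let K := 2 * B.
Let K_gt0 : 0 < K. Proof. by rewrite mulr_gt0. Qed.
Let M := \sum_j `|a j|.

(** One integration with the weight [expR (K * `|x|)] divides the bound by [K],
    and [K = 2 * B] turns the factor [B] of the coefficients into 1/2. *)
Lemma picard_step k i x :
  `|picard k.+1 i x - picard k i x| <= M * 2^-1 ^+ k * expR (K * `|x|).
Proof.
have M0 : 0 <= M by apply: sumr_ge0.
elim: k i x => [|k IH] i x; last first.
  apply: (@derive_le_expR_norm R (fun y => picard k.+2 i y - picard k.+1 i y)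
   (fun y => \sum_j A i j y * (picard k.+1 j y - picard k j y))) => //.
  - by rewrite mulr_ge0// exprn_ge0.
  - by rewrite !picard0 subrr.
  - move=> y; have := picard_derive k i y; have := picard_derive k.+1 i y => ? ?.
    diff; rewrite -sumrN -big_split /=; apply: eq_bigr => j _; ring.
  - move=> y; apply: le_trans (sumM_le _ _ (fun j => IH j y)) _.
    by rewrite exprS /K le_eqVlt; apply/orP; left; apply/eqP; field.
have aM j : `|a j| <= M by rewrite /M (bigD1 j)//= lerDl sumr_ge0.
rewrite expr0 mulr1.
apply: (@derive_le_expR_norm R (fun y => picard 1 i y - a i)
   (fun y => \sum_j A i j y * a j)) => //.
- by rewrite picard0 subrr.
- move=> y; have := picard_derive 0 i y => ?; diff.
  by rewrite addr0.
- move=> y; apply: le_trans (sumM_le _ _ aM) _.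
  have : 1 <= expR (K * `|y|) by rewrite -expR0 ler_expR mulr_ge0// ltW.
  have : 0 <= B * M by rewrite mulr_ge0// ltW.
  by rewrite /K => BM e1; have := ler_wpM2l BM e1; nra.
Qed.

(** The iterates converge locally uniformly, so the limit [w] is continuous and
    [A w] has a primitive; the weighted estimate identifies [w] with the initial
    value plus that primitive. *)
Lemma linear_system_solution : exists w : I -> R -> R,
  (forall i, w i 0 = a i) /\
  (forall i (x : R), is_derive x 1 (w i) (\sum_j A i j x * w j x)).
Proof.
have M0 : 0 <= M by apply: sumr_ge0.
have /choice[w0 w0P] : forall ix : I * R, exists l, forall k,
    `|picard k ix.1 ix.2 - l| <= 2 * (M * expR (K * `|ix.2|)) * 2^-1 ^+ k.
  move=> [i x]; apply: geometric_limit => k /=.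
  by rewrite mulrAC; exact: picard_step.
pose w i x := w0 (i, x).
have wP i x k : `|picard k i x - w i x| <= 2 * M * 2^-1 ^+ k * expR (K * `|x|).
  apply: le_trans (w0P (i, x) k) _ => /=.
  by rewrite le_eqVlt; apply/orP; left; apply/eqP; ring.
have wc i : continuous (w i).
  move=> x; apply/cvgrPdist_lt => /= e e0.
  pose E := expR (K * (`|x| + 1)).
  have E0 : 0 < E := expR_gt0 _.
  (* otherwise a positive number would be below a null geometric sequence *)
  have [k ke] : exists k, 2 * M * 2^-1 ^+ k * E < e / 3.
    apply: contrapT => /forallNP H.
    have : e / 3 = 0.
      apply: (@geometric_small_eq0 _ (2 * M * E)) => k.
      rewrite gtr0_norm ?divr_gt0// mulrAC leNgt; apply/negP; exact: H.
    lra.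
  have wk y : `|y| <= `|x| + 1 -> `|picard k i y - w i y| < e / 3.
    move=> yx; apply: le_lt_trans (wP i y k) _; apply: le_lt_trans ke.
    rewrite ler_wpM2l// ?mulr_ge0// ?exprn_ge0// ler_expR ler_wpM2l// ltW//.
  have /cvgrPdist_lt/(_ (e / 3)) := @picard_continuous k i x.
  have e3 : 0 < e / 3 by lra.
  move=> /(_ e3) pc; near=> y.
  have h1 : `|picard k i x - picard k i y| < e / 3 by near: y.
  have h2 : `|picard k i x - w i x| < e / 3 by apply: wk; rewrite lerDl.
  have h3 : `|picard k i y - w i y| < e / 3.
    apply: wk; rewrite -lerBlDl; apply: le_trans (lerB_dist _ _) _.
    by rewrite distrC ltW//; near: y; apply: cvgr_dist_lt.
  have -> : w i x - w i y = (picard k i x - picard k i y)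
     - (picard k i x - w i x) + (picard k i y - w i y) by ring.
  apply: le_lt_trans (ler_normD _ _) _.
  apply: le_lt_trans (lerD (ler_normB _ _) (lexx _)) _; lra.
pose F i := primitive (fun t => \sum_j A i j t * w j t).
have FD i (x : R) : is_derive x 1 (F i) (\sum_j A i j x * w j x).
  by apply: is_derive_primitive; apply: continuous_sumM.
have F0 i : F i 0 = 0 by apply: primitive0; apply: continuous_sumM.
have wF i x : w i x = a i + F i x.
  apply/eqP; rewrite -subr_eq0; apply/eqP.
  apply: (@geometric_small_eq0 _ (2 * M * expR (K * `|x|))) => k.
  have h1 := wP i x k.+1.
  have h2 : `|picard k.+1 i x - a i - F i x| <= M * 2^-1 ^+ k * expR (K * `|x|).
    apply: (@derive_le_expR_norm R (fun y => picard k.+1 i y - a i - F i y)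
      (fun y => \sum_j A i j y * (picard k j y - w j y))) => //.
    - by rewrite mulr_ge0// exprn_ge0.
    - by rewrite picard0 F0 subrr subr0.
    - move=> y; have := picard_derive k i y; have := FD i y => ? ?.
      diff; rewrite addr0 -sumrN -big_split /=; apply: eq_bigr => j _; ring.
    - move=> y; apply: le_trans (sumM_le _ _ (fun j => wP j y k)) _.
      by rewrite /K le_eqVlt; apply/orP; left; apply/eqP; ring.
  have -> : w i x - (a i + F i x) =
    (picard k.+1 i x - a i - F i x) - (picard k.+1 i x - w i x) by ring.
  apply: le_trans (ler_normB _ _) _.
  move: h1 h2; rewrite exprS mulrAC.
  lra.
exists w; split => [i|i x]; first by rewrite wF F0 addr0.
have -> : w i = fun y => a i + F i y by apply/funext => y; exact: wF.
have ? := FD i x.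
by diff; rewrite add0r.
Unshelve. all: by end_near. Qed.

End linear_system.

(** * A priori estimate and second order systems *)

Section system_estimate.
Context {R : realType}.

(** Gronwall for the sum of squares of [D], after Young's inequality on the
    products [D j * D k] and [D j * e]. The case [e = 0] is uniqueness, and the
    general case is Lipschitz dependence on parameters, [e] being the size
    of the change of the equation. *)
Lemma linear_system_estimate (I : finType) (B T : R) : 0 <= B -> 0 <= T ->
  exists2 M, 0 <= M & forall (D E : I -> R -> R) (e : R), 0 <= e ->
    (forall i, D i 0 = 0) ->
    (forall i x, 0 <= x <= T -> is_derive x 1 (D i) (E i x)) ->
    (forall i x, 0 <= x <= T -> `|E i x| <= B * (\sum_j `|D j x|) + e) ->
    forall i, `|D i T| <= M * e.
Proof.
move=> B0 T0; pose n : R := #|I|%:R; pose K := B * n *+ 2 + 1.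
have n0 : 0 <= n by [].
have K0 : 0 <= K by rewrite /K addr_ge0// mulrn_wge0// mulr_ge0.
exists (Num.sqrt (n * T * expR (K * T))) => [|D E e e0 D0 DE E_le i].
  exact: sqrtr_ge0.
have : \sum_j D j T ^+ 2 <= n * e ^+ 2 * T * expR (K * T).
  apply: (@gronwall _ (fun x => \sum_j D j x ^+ 2)
    (fun x => \sum_j 2 * D j x * E j x)) => //.
  - by rewrite mulr_ge0// exprn_ge0.
  - by rewrite big1// => j _; rewrite D0 expr0n.
  - move=> x xT; apply: derive_pt_sum => j; have ? := DE j x xT.
    by diff; rewrite expr1.
  - move=> x xT.
    have le1 j : 2 * D j x * E j x <=
        B * (\sum_k (D j x ^+ 2 + D k x ^+ 2)) + (D j x ^+ 2 + e ^+ 2).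
      apply: (@le_trans _ _ (2 * `|D j x| * (B * (\sum_k `|D k x|) + e))).
        apply: le_trans (ler_norm _) _; rewrite !normrM ger0_norm//.
        by rewrite ler_wpM2l ?mulr_ge0// E_le.
      rewrite mulrDr lerD//.
        rewrite mulrCA ler_wpM2l// mulr_sumr; apply: ler_sum => k _.
        rewrite -[in leRHS](real_normK (num_real (D j x))).
        rewrite -[in leRHS](real_normK (num_real (D k x))).
        by have := sqr_ge0 (`|D j x| - `|D k x|); nra.
      rewrite -[in leRHS](real_normK (num_real (D j x))).
      by have := sqr_ge0 (`|D j x| - e); nra.
    apply: le_trans (ler_sum _ (fun j _ => le1 j)) _.
    set h := \sum_j D j x ^+ 2.
    have -> : \sum_j (B * (\sum_k (D j x ^+ 2 + D k x ^+ 2)) + (D j x ^+ 2 + e ^+ 2))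
       = B * (n * h + n * h) + (h + n * e ^+ 2).
      rewrite !big_split /= -mulr_sumr; congr (B * _ + (_ + _)).
        under eq_bigr do rewrite big_split /= -/h.
        rewrite big_split /=; congr (_ + _).
          by under eq_bigr do rewrite sumr_const -mulr_natl; rewrite -mulr_sumr.
        by rewrite sumr_const -mulr_natl.
      by rewrite sumr_const -mulr_natl.
    by rewrite /K; lra.
rewrite (bigD1 i)//= => h.
have Dsq : D i T ^+ 2 <= n * T * expR (K * T) * e ^+ 2.
  have : 0 <= \sum_(j | j != i) D j T ^+ 2.
    by apply: sumr_ge0 => j _; exact: sqr_ge0.
  by move: h; lra.
rewrite -[leLHS]sqrtr_sqr -[leRHS]ger0_norm; last first.
  by rewrite mulr_ge0// sqrtr_ge0.
rewrite -sqrtr_sqr ler_sqrt ?sqr_ge0// exprMn sqr_sqrtr//.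
by rewrite !mulr_ge0// expR_ge0.
Qed.

(** Reduction to first order over the index type [J + J]: [inl] for the
    functions and [inr] for their derivatives. *)
Lemma second_order_solution (J : finType) (Q : J -> J -> R -> R) (B : R)
    (b : J -> R) :
  (forall j k, continuous (Q j k)) ->
  0 <= B -> (forall j x, \sum_k `|Q j k x| <= B) ->
  exists w v : J -> R -> R, [/\ forall j, w j 0 = 0, forall j, v j 0 = b j,
    forall j (x : R), is_derive x 1 (w j) (v j x) &
    forall j (x : R), is_derive x 1 (v j) (\sum_k Q j k x * w k x)].
Proof.
move=> Qc B0 Q_le.
pose A (i j : J + J) : R -> R := match i, j with
  | inl j, inr k => fun=> (j == k)%:R
  | inr j, inl k => Q j k
  | _, _ => fun=> 0
  end.
pose a (i : J + J) : R := if i is inr j then b j else 0.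
have [||i x|w [w0 wD]] := @linear_system_solution R _ A (B + 1) a.
- by move=> [j|j] [k|k] x /=; try exact: cvg_cst; exact: Qc.
- by rewrite ltr_wpDl.
- case: i => j; rewrite big_sumType /=.
    rewrite big1 ?normr0// add0r (bigD1 j)//= eqxx normr1 big1 ?addr0 ?lerDr//.
    by move=> k; rewrite eq_sym => /negPf->; rewrite normr0.
  rewrite [X in _ + X]big1 ?normr0// addr0.
  by apply: le_trans (Q_le j x) _; rewrite lerDl.
exists (fun j => w (inl j)), (fun j => w (inr j)); split => [j|j|j x|j x].
- by rewrite w0.
- by rewrite w0.
- apply: is_derive_eq (wD (inl j) x) _; rewrite big_sumType /=.
  rewrite big1; last by move=> k _; rewrite mul0r.
  rewrite add0r.
  rewrite (bigD1 j)//= eqxx mul1r big1 ?addr0// => k.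
  by rewrite eq_sym => /negPf->; rewrite mul0r.
- apply: is_derive_eq (wD (inr j) x) _; rewrite big_sumType /=.
  by rewrite [X in _ + X]big1 ?addr0// => k _; rewrite mul0r.
Qed.

Lemma second_order_estimate (J : finType) (B T : R) : 0 <= B -> 0 <= T ->
  exists2 M, 0 <= M & forall (w v f : J -> R -> R) (e : R), 0 <= e ->
    (forall j, w j 0 = 0) -> (forall j, v j 0 = 0) ->
    (forall j x, 0 <= x <= T -> is_derive x 1 (w j) (v j x)) ->
    (forall j x, 0 <= x <= T -> is_derive x 1 (v j) (f j x)) ->
    (forall j x, 0 <= x <= T -> `|f j x| <= B * (\sum_k `|w k x|) + e) ->
    forall j, `|w j T| <= M * e /\ `|v j T| <= M * e.
Proof.
move=> B0 T0.
have [||M M0 HM] := @linear_system_estimate (J + J)%type (B + 1) T => //.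
  exact: addr_ge0.
exists M => // w v f e e0 w0 v0 wD vD f_le j.
pose D (i : J + J) := match i with inl j => w j | inr j => v j end.
pose E (i : J + J) := match i with inl j => v j | inr j => f j end.
have DE := HM D E e e0.
suff H i : `|D i T| <= M * e by split; [exact: (H (inl j))|exact: (H (inr j))].
apply: DE => [[k|k]|[k|k] x xT|[k|k] x xT] /=; rewrite ?w0 ?v0//.
- exact: wD.
- exact: vD.
- rewrite big_sumType /= mulrDr !mulrDl !mul1r.
  have s1 : 0 <= \sum_k `|w k x| by apply: sumr_ge0.
  have s2 : `|v k x| <= \sum_k `|v k x| by rewrite (bigD1 k)//= lerDl sumr_ge0.
  have s3 := le_trans (normr_ge0 _) s2.
  have := mulr_ge0 B0 s1; have := mulr_ge0 B0 s3; lra.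
- rewrite big_sumType /= mulrDr !mulrDl !mul1r.
  have s1 : 0 <= \sum_k `|w k x| by apply: sumr_ge0.
  have s3 : 0 <= \sum_k `|v k x| by apply: sumr_ge0.
  have := f_le k x xT; have := mulr_ge0 B0 s3; lra.
Qed.

End system_estimate.

(** * Uniqueness and Sturm comparison *)

Section scalar_tools.
Context {R : realType}.
Implicit Types (f g : R -> R) (a b x y T : R).

Lemma continuous_zero f a b : a <= b -> continuous f -> 0 < f a -> f b <= 0 ->
  exists2 c, a < c <= b & f c = 0.
Proof.
move=> ab fc fa fb.
have [||c] := @IVT R f a b 0 ab.
- exact: continuous_subspaceT.
- by rewrite ge_min le_max fb (ltW fa) orbT.
- rewrite in_itv/= le_eqVlt => /andP[/predU1P[<-|ac] cb] fc0.
    by rewrite fc0 ltxx in fa.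
  by exists c => //; rewrite ac.
Qed.

Lemma continuous_bounded f a b : continuous f ->
  exists2 P, 0 <= P & forall x, a <= x <= b -> `|f x| <= P.
Proof.
move=> fc; have [ab|ab] := leP a b; last first.
  by exists 0 => // x /andP[ax xb]; have := le_trans ax xb; rewrite leNgt ab.
have [|c cab c_max] := @EVT_max R (fun x => `|f x|) a b ab.
  apply: continuous_subspaceT => x.
  by apply: cvg_norm; exact: fc.
by exists `|f c| => // x xab; apply: c_max; rewrite in_itv.
Qed.

Lemma second_order_unique (J : finType) (w v s : J -> R -> R) :
  (forall j, w j 0 = 0) -> (forall j, v j 0 = 0) ->
  (forall j (x : R), is_derive x 1 (w j) (v j x)) ->
  (forall j (x : R), is_derive x 1 (v j) (s j x)) ->
  (forall T, 0 <= T -> exists2 B, 0 <= B &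
    forall j x, 0 <= x <= T -> `|s j x| <= B * \sum_k `|w k x|) ->
  forall j x, 0 <= x -> w j x = 0 /\ v j x = 0.
Proof.
move=> w0 v0 wD vD s_le j x x0.
have [B B0 sB] := s_le x x0.
have [M M0 HM] := @second_order_estimate R J B x B0 x0.
have [|wx vx] := HM w v s 0 (lexx 0) w0 v0 (fun k y _ => wD k y)
    (fun k y _ => vD k y) _ j.
  by move=> k y yx; rewrite addr0; exact: sB.
by rewrite mulr0 in wx vx; split; apply/eqP; rewrite -normr_le0.
Qed.

(** Here [h] is a positive supersolution. With [k = dy * h - y * dh], the
    quotient [y / h] has derivative [k / h ^+ 2] and [k] has derivative
    [y * (c * h - s)]. Hence [(y / h) * k] is nondecreasing, so [y * k >= 0];
    then [k ^+ 2] is nondecreasing too, and [k], which is positive at 0, keeps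
    its sign. So [y / h] increases from 0. *)
Lemma sturm_positive (h dh s y dy c : R -> R) (m : R) :
  (forall x : R, is_derive x 1 h (dh x)) -> (forall x : R, is_derive x 1 dh (s x)) ->
  (forall x : R, is_derive x 1 y (dy x)) ->
  (forall x : R, is_derive x 1 dy (c x * y x)) ->
  (forall x, 0 <= x < m -> 0 < h x) ->
  (forall x, 0 <= x < m -> s x <= c x * h x) ->
  y 0 = 0 -> 0 < dy 0 -> forall x, 0 < x < m -> 0 < y x.
Proof.
move=> hD dhD yD dyD h_gt0 s_le y0 dy0 t /andP[t0 tm].
pose k x := dy x * h x - y x * dh x.
have kD x : is_derive x 1 k (y x * (c x * h x - s x)).
  by rewrite /k; diff; ring.
have h0 : 0 < h 0 by rewrite h_gt0// lexx (lt_trans t0).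
have k0 : 0 < k 0 by rewrite /k y0 mul0r subr0 mulr_gt0.
have uD x : 0 <= x < m -> is_derive x 1 (fun x => y x * (h x)^-1) (k x / h x ^+ 2).
  move=> /h_gt0 hx; have hn0 : h x != 0 by rewrite gt_eqF.
  have ? := derive_ptV hn0 (hD x).
  by diff; rewrite /k; field.
have yk x : 0 <= x < m -> 0 <= y x * k x.
  move=> /andP[x0 xm]; have hx : 0 < h x by rewrite h_gt0// x0.
  have : 0 <= (y x * (h x)^-1) * k x.
    have -> : 0 = (y 0 * (h 0)^-1) * k 0 by rewrite y0 !mul0r.
    apply: (@derive_ge0_le _ (fun x => (y x * (h x)^-1) * k x)
      (fun x => (k x / h x) ^+ 2 + (y x) ^+ 2 / h x * (c x * h x - s x)) 0 x x0).
      move=> z /andP[z0 zx]; have zm : 0 <= z < m by rewrite z0 (le_lt_trans zx).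
      have hz : h z != 0 by rewrite gt_eqF// h_gt0.
      have ? := uD z zm; have ? := kD z.
      apply: is_derive_eq (derive_ptM (uD z zm) (kD z)) _.
      by field.
    move=> z /andP[z0 zx].
    have zm : 0 <= z < m by rewrite (ltW z0) (lt_trans zx).
    rewrite addr_ge0 ?sqr_ge0// mulr_ge0// ?subr_ge0 ?s_le//.
    by rewrite mulr_ge0 ?sqr_ge0// invr_ge0 ltW// h_gt0.
  by rewrite mulrAC pmulr_lge0// invr_gt0.
have k2 x : 0 <= x < m -> k 0 ^+ 2 <= k x ^+ 2.
  move=> /andP[x0 xm].
  apply: (@derive_ge0_le _ (fun x => k x ^+ 2)
    (fun x => 2 * (y x * k x) * (c x * h x - s x)) 0 x x0).
    by move=> z _; diff; ring.
  move=> z /andP[z0 zx].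
  have zm : 0 <= z < m by rewrite (ltW z0) (lt_trans zx).
  by rewrite mulr_ge0// ?subr_ge0 ?s_le// mulr_ge0// yk.
have k_gt0 x : 0 <= x < m -> 0 < k x.
  move=> /andP[x0 xm]; rewrite ltNge; apply/negP => kx.
  have [|d /andP[d0 dx] kd] := @continuous_zero k 0 x x0 _ k0 kx.
    by move=> z; exact: is_derive_continuous (kD z).
  have := k2 d; rewrite (ltW d0) (le_lt_trans dx)// kd expr0n/= => /(_ isT).
  by rewrite leNgt exprn_gt0.
have ht : 0 < h t by rewrite h_gt0// (ltW t0).
have : y 0 * (h 0)^-1 < y t * (h t)^-1.
  apply: (@derive_gt0_lt _ (fun x => y x * (h x)^-1) (fun x => k x / h x ^+ 2)) => //.
    by move=> z /andP[z0 zt]; apply: uD; rewrite z0 (le_lt_trans zt).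
  move=> z /andP[z0 zt]; have zm : 0 <= z < m by rewrite (ltW z0) (lt_trans zt).
  by rewrite divr_gt0// ?k_gt0// exprn_gt0// h_gt0.
by rewrite y0 mul0r pmulr_lgt0// invr_gt0.
Qed.

End scalar_tools.

(** * Phase plane analysis of the profile *)

Section profile.
Context {R : realType}.
Variables (omega : R) (n : nat).
Hypothesis n_even : ~~ odd n.
Implicit Types (f g : R -> R) (x c L : R).

Definition profile_eq f g : Prop :=
  (forall x : R, is_derive x 1 f (g x)) /\
  (forall x : R, is_derive x 1 g (omega * f x - f x ^+ n.+1)).

Lemma subrX_le (a b P : R) k : 0 <= P -> `|a| <= P -> `|b| <= P ->
  `|a ^+ k - b ^+ k| <= k%:R * P ^+ k.-1 * `|a - b|.
Proof.
move=> P0 aP bP; rewrite subrXX normrM mulrC ler_wpM2r//.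
apply: le_trans (ler_norm_sum _ _ _) _.
rewrite -[k in k%:R]card_ord mulr_natl -sumr_const; apply: ler_sum => i _.
rewrite normrM !normrX -[X in P ^+ X](@subnK i) ?exprD; last first.
  by rewrite -ltnS (ltn_predK (ltn_ord i)).
by apply: ler_pM; rewrite ?exprn_ge0// lerXn2r// nnegrE.
Qed.

Lemma profile_eq_unique f1 g1 f2 g2 : profile_eq f1 g1 -> profile_eq f2 g2 ->
  f1 0 = f2 0 -> g1 0 = g2 0 -> f1 =1 f2.
Proof.
have half h1 k1 h2 k2 : profile_eq h1 k1 -> profile_eq h2 k2 ->
    h1 0 = h2 0 -> k1 0 = k2 0 -> forall x, 0 <= x -> h1 x = h2 x.
  move=> [h1D k1D] [h2D k2D] h0 k0 x x0; apply/eqP; rewrite -subr_eq0; apply/eqP.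
  have [||T T0|//] := @second_order_unique R unit (fun _ y => h1 y - h2 y)
    (fun _ y => k1 y - k2 y) (fun _ y =>
      (omega * h1 y - h1 y ^+ n.+1) - (omega * h2 y - h2 y ^+ n.+1))
    _ _ _ _ _ tt x x0.
  - by rewrite h0 subrr.
  - by rewrite k0 subrr.
  have [P1 P10 h1P] := @continuous_bounded R h1 0 T
    (fun y => is_derive_continuous (h1D y)).
  have [P2 P20 h2P] := @continuous_bounded R h2 0 T
    (fun y => is_derive_continuous (h2D y)).
  exists (`|omega| + n.+1%:R * (P1 + P2) ^+ n) => [|_ y yT].
    by rewrite addr_ge0// mulr_ge0// exprn_ge0// addr_ge0.
  rewrite (bigD1 tt)//= big1 ?addr0; last by case.
  have -> : omega * h1 y - h1 y ^+ n.+1 - (omega * h2 y - h2 y ^+ n.+1) =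
    omega * (h1 y - h2 y) - (h1 y ^+ n.+1 - h2 y ^+ n.+1) by ring.
  apply: le_trans (ler_normB _ _) _; rewrite mulrDl normrM lerD2l.
  apply: subrX_le; first exact: addr_ge0.
    by apply: le_trans (h1P y yT) _; rewrite lerDl.
  by apply: le_trans (h2P y yT) _; rewrite lerDr.
move=> e1 e2 f0 g0 x; have [x0|x0] := leP 0 x; first exact: half e1 e2 f0 g0 x x0.
rewrite -[x]opprK.
have refl f g : profile_eq f g -> profile_eq (fun y => f (- y)) (fun y => - g (- y)).
  by move=> [fD gD]; split => y; diff; ring.
apply: (half _ _ _ _ (refl _ _ e1) (refl _ _ e2)); rewrite ?oppr0 ?g0//.
by rewrite oppr_ge0 ltW.
Qed.

(** The equation is invariant under [f |-> - f] (the exponent [n] is even), under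
    translations and under reflection. *)
Lemma profile_eq_sym f g (s t c : R) : s ^+ 2 = 1 -> t ^+ 2 = 1 ->
  profile_eq f g ->
  profile_eq (fun x => s * f (c + t * x)) (fun x => s * t * g (c + t * x)).
Proof.
move=> s1 t1 [fD gD]; split => x; diff; first by ring.
have sn : s ^+ n = 1.
  by rewrite -(odd_double_half n) (negPf n_even) add0n -mul2n exprM s1 expr1n.
rewrite exprMn (exprS s) sn.
transitivity (s * t ^+ 2 * (omega * f (c + t * x) - f (c + t * x) ^+ n.+1)).
  by ring.
by rewrite t1; ring.
Qed.

Lemma profile_eq_energy f g : profile_eq f g -> forall x,
  g x ^+ 2 - omega * f x ^+ 2 + 2 / n.+2%:R * f x ^+ n.+2 =
  g 0 ^+ 2 - omega * f 0 ^+ 2 + 2 / n.+2%:R * f 0 ^+ n.+2.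
Proof.
move=> [fD gD] x.
apply: (@is_derive_0_is_cst R (fun x => g x ^+ 2 - omega * f x ^+ 2
  + 2 / n.+2%:R * f x ^+ n.+2)) => y.
diff.
have : n.+2%:R != 0 :> R by rewrite pnatr_eq0.
by move=> n0; rewrite /=; field.
Qed.

Context (L : R) (f g : R -> R).
Hypotheses (L_gt0 : 0 < L) (f_eq : profile_eq f g) (f_odd : odd_fun f)
  (f_per : minimal_period f L).

Lemma profile0 : f 0 = 0.
Proof. by have := f_odd 0; rewrite oppr0; lra. Qed.

Lemma profile_slope0 : g 0 != 0.
Proof.
have L0 := L_gt0.
apply/eqP => g0; have f0 : f =1 (fun=> 0).
  apply: (profile_eq_unique f_eq (g2 := fun=> 0)); rewrite ?profile0//.
  by split => x; apply: is_derive_eq; rewrite ?mulr0 ?expr0n ?subr0//=;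
    exact: derive_ptC.
have [_ /(_ (L / 2))] := f_per; apply; [lra|lra|].
by move=> x; rewrite !f0.
Qed.

Lemma profile_half_period : f (L / 2) = 0.
Proof.
have L0 := L_gt0.
have [fL _] := f_per; have := fL (- (L / 2)); rewrite f_odd.
have -> : - (L / 2) + L = L / 2 by field.
by move=> h; lra.
Qed.

(** At a zero [x] the energy gives [g x ^+ 2 = g 0 ^+ 2], so [f (x + y)] is
    [f y] or [- f y] by uniqueness; in both cases [2 * x] is a period. *)
Lemma profile_nonzero x : 0 < x < L / 2 -> f x <> 0.
Proof.
have L0 := L_gt0.
move=> /andP[x0 xL] fx.
have := profile_eq_energy f_eq x; rewrite fx profile0.
rewrite !expr0n/= !mulr0 !subr0 !addr0 => gx.
pose s := g x / g 0.
have s1 : s ^+ 2 = 1.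
  by rewrite /s expr_div_n gx divff// expf_neq0// profile_slope0.
have fxE y : f (x + y) = s * f y.
  have e1 := profile_eq_sym x (expr1n R 2) (expr1n R 2) f_eq.
  have e2 := profile_eq_sym 0 s1 (expr1n R 2) f_eq.
  have := profile_eq_unique e1 e2.
  rewrite /= !mulr0 !addr0 fx profile0 !mulr0 !mul1r => /(_ erefl).
  rewrite mulr1 /s divfK ?profile_slope0// => /(_ erefl y).
  by rewrite !mul1r add0r.
have [_ /(_ (2 * x))] := f_per; apply; [lra|lra|].
move=> y; have -> : y + 2 * x = x + (x + y) by ring.
by rewrite !fxE mulrA -expr2 s1 mul1r.
Qed.

(** By uniqueness [f] is even about a critical point [x], so [2 * x] is a zero of
    [f]; [profile_nonzero], oddness and periodicity leave only L / 2 as a zero in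
    (0, L). *)
Lemma profile_critical x : 0 < x < L / 2 -> g x = 0 ->
  x = L / 4 /\ forall y, f (x + y) = f (x - y).
Proof.
have L0 := L_gt0.
move=> /andP[x0 xL] gx.
have N1 : (-1) ^+ 2 = 1 :> R by rewrite sqrrN expr1n.
have fs y : f (x + y) = f (x - y).
  have e1 := profile_eq_sym x (expr1n R 2) (expr1n R 2) f_eq.
  have e2 := profile_eq_sym x (expr1n R 2) N1 f_eq.
  have := profile_eq_unique e1 e2; rewrite /= !mulr0 !addr0 gx !mulr0.
  by move=> /(_ erefl erefl y); rewrite !mul1r mulN1r.
split => //.
have f2x : f (2 * x) = 0 by have := fs x; rewrite subrr profile0 mulr2n mulrDl mul1r.
have [lt2|gt2|eq2] := ltgtP (2 * x) (L / 2); last by lra.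
  by case: (@profile_nonzero (2 * x)); [apply/andP; split; lra|].
case: (@profile_nonzero (L - 2 * x)); first by apply/andP; split; lra.
have [fL _] := f_per.
by rewrite addrC fL f_odd f2x oppr0.
Qed.

Lemma profile_quarter :
  [/\ g (L / 4) = 0, forall y, f (L / 4 + y) = f (L / 4 - y) &
      forall x, 0 < x < L / 4 -> g x <> 0].
Proof.
have L0 := L_gt0.
have [fD gD] := f_eq.
have [||||c] := @Rolle R f 0 (L / 2).
- by lra.
- by move=> x _; have [] := fD x.
- by apply: continuous_subspaceT => x; exact: is_derive_continuous (fD x).
- by rewrite profile0 profile_half_period.
rewrite in_itv/= => c_in fc.
have gc : g c = 0 by have [_ <-] := fD c; have [_ ->] := fc.
have [cE cs] := profile_critical c_in gc; subst c; split => // x /andP[x0 xm] gx.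
have xin : 0 < x < L / 2 by apply/andP; split; lra.
by have [xE _] := profile_critical xin gx; rewrite xE ltxx in xm.
Qed.

Hypothesis slope_gt0 : 0 < g 0.

Lemma profile_slope_gt0 x : 0 <= x < L / 4 -> 0 < g x.
Proof.
move=> /andP[x0 xm]; have [_ gD] := f_eq.
rewrite ltNge; apply/negP => gx.
have [|c /andP[c0 cx] gc] := @continuous_zero R g 0 x x0 _ slope_gt0 gx.
  by move=> y; exact: is_derive_continuous (gD y).
have [_ _ /(_ c)] := profile_quarter; rewrite c0 (le_lt_trans cx)//.
by move=> /(_ isT).
Qed.

Lemma profile_gt0 x : 0 < x <= L / 4 -> 0 < f x.
Proof.
move=> /andP[x0 xm]; rewrite -profile0; have [fD _] := f_eq.
apply: (@derive_gt0_lt _ f g) => // y /andP[y0 yx].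
by apply: profile_slope_gt0; rewrite ltW//= (lt_le_trans yx).
Qed.

(** By oddness and periodicity the values on [0, L] suffice. *)
Lemma profile_bounded : exists2 P, 0 <= P & forall x, `|f x| <= P.
Proof.
have [fD _] := f_eq.
have [P P0 fP] := @continuous_bounded R f 0 L
    (fun y => is_derive_continuous (fD y)).
exists P => // x.
have pos y : 0 <= y -> `|f y| <= P.
  move=> y0; pose k := Num.trunc (y / L).
  have yL0 : 0 <= y / L by rewrite divr_ge0// ltW.
  have /andP[k1 k2] := truncn_itv yL0.
  have [fL _] := f_per.
  have := periodicn fL k (y - L *+ k); rewrite subrK => ->; apply: fP.
  move: k1 k2; rewrite -/k -[L *+ k]mulr_natl ler_pdivlMr// ltr_pdivrMr//.
  by rewrite -addn1 natrD mulrDl mul1r => ? ?; apply/andP; split; lra.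
have [x0|x0] := leP 0 x; first exact: pos.
by rewrite -normrN -f_odd; apply: pos; rewrite oppr_ge0 ltW.
Qed.

End profile.

(** * Shooting for the coupled system *)

Section coupled_system.
Context {R : realType}.
Implicit Types (q : bool -> R -> R) (p l P T x y : R) (w v : bool -> R -> R).

(** The booleans [true] and [false] stand for the first and second component. *)
Definition coupling (c : bool) : R := if c then 1 else - 1.

Definition coupled q p l w v : Prop :=
  (forall c (x : R), is_derive x 1 (w c) (v c x)) /\
  (forall c (x : R), is_derive x 1 (v c)
     ((q c x + p) * w c x + coupling c * l * w (~~ c) x)).

Lemma normr_coupling c : `|coupling c| = 1.
Proof. by case: c; rewrite /= ?normrN normr1. Qed.

Lemma sum_bool_negb (F : bool -> R) c : \sum_b F b = F c + F (~~ c).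
Proof. by rewrite big_bool; case: c => //=; rewrite addrC. Qed.

Lemma coupled_rhs_le q P p l w x c : (forall c x, `|q c x| <= P) ->
  `|(q c x + p) * w c x + coupling c * l * w (~~ c) x| <=
  (P + `|p| + `|l|) * \sum_b `|w b x|.
Proof.
move=> qP; rewrite (sum_bool_negb _ c); apply: le_trans (ler_normD _ _) _.
rewrite !normrM normr_coupling mul1r.
have h1 : `|q c x + p| <= P + `|p|.
  by apply: le_trans (ler_normD _ _) _; rewrite lerD2r.
have P0 : 0 <= P := le_trans (normr_ge0 _) (qP c x).
have h2 := ler_wpM2r (normr_ge0 (w c x)) h1.
have h3 := mulr_ge0 (normr_ge0 l) (normr_ge0 (w c x)).
have h4 := mulr_ge0 (addr_ge0 P0 (normr_ge0 p)) (normr_ge0 (w (~~ c) x)).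
by rewrite mulrDr !mulrDl in h2 h4 *; lra.
Qed.

Lemma coupled_solution q P p l (b : bool -> R) :
  (forall c, continuous (q c)) -> (forall c x, `|q c x| <= P) ->
  exists wv : (bool -> R -> R) * (bool -> R -> R),
  [/\ coupled q p l wv.1 wv.2, forall c, wv.1 c 0 = 0 & forall c, wv.2 c 0 = b c].
Proof.
move=> qc qP; have P0 : 0 <= P := le_trans (normr_ge0 _) (qP true 0).
pose Q c d x := if c == d then q c x + p else coupling c * l.
have [||c x|w [v [w0 v0 wD vD]]] := @second_order_solution R bool Q (P + `|p| + `|l|) b.
- move=> c d; rewrite /Q; case: (c == d) => x; last exact: cvg_cst.
  by apply: cvgD; [exact: qc|exact: cvg_cst].
- by rewrite !addr_ge0.
- rewrite (sum_bool_negb _ c) /Q eqxx; case: eqP => [|_]; first by case: (c).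
  rewrite normrM normr_coupling mul1r lerD2r.
  by apply: le_trans (ler_normD _ _) _; rewrite lerD2r.
exists (w, v); split => //=; split => // c x.
apply: is_derive_eq (vD c x) _.
by rewrite (sum_bool_negb _ c) /Q eqxx; case: eqP => [|_//]; case: (c).
Qed.

Lemma coupled_unique q P p l w v : (forall c x, `|q c x| <= P) ->
  coupled q p l w v -> (forall c, w c 0 = 0) -> (forall c, v c 0 = 0) ->
  forall c x, 0 <= x -> w c x = 0.
Proof.
move=> qP [wD vD] w0 v0 c x x0.
have [T T0|//] := @second_order_unique R bool w v _ w0 v0 wD vD _ c x x0.
exists (P + `|p| + `|l|); last by move=> d y _; exact: coupled_rhs_le.
by rewrite !addr_ge0// (le_trans (normr_ge0 _) (qP true 0)).
Qed.

(** The difference of the solutions for [s] and [s0] solves the system for [s]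
    with a source term of the size of the change of the parameters, and
    [second_order_estimate] applies. *)
Lemma coupled_continuous q P (p l : R -> R) (b : bool -> R)
    (W V : R -> bool -> R -> R) T :
  (forall c x, `|q c x| <= P) -> continuous p -> continuous l ->
  (forall s, coupled q (p s) (l s) (W s) (V s)) ->
  (forall s c, W s c 0 = 0) -> (forall s c, V s c 0 = b c) ->
  0 <= T -> forall c, continuous (fun s => V s c T).
Proof.
move=> qP pc lc WV W0 V0 T0 c s0.
have P0 : 0 <= P := le_trans (normr_ge0 _) (qP true 0).
have [WD VD] := WV s0.
have bnd d := @continuous_bounded R (W s0 d) 0 T
  (fun y => is_derive_continuous (WD d y)).
have [N1 N10 HN1] := bnd true; have [N2 N20 HN2] := bnd false.
have HN d x : 0 <= x <= T -> `|W s0 d x| <= N1 + N2.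
  by move=> xT; case: d; [have := HN1 x xT|have := HN2 x xT]; lra.
pose B := P + (`|p s0| + 1) + (`|l s0| + 1).
have B0 : 0 <= B by rewrite /B !addr_ge0.
have [M M0 HM] := @second_order_estimate R bool B T B0 T0.
apply/cvgrPdist_lt => /= e e0.
pose eta := Num.min 1 (e / (2 * (M * (N1 + N2)) + 1)).
have MN0 : 0 <= M * (N1 + N2) by rewrite mulr_ge0// addr_ge0.
have MN1 : 0 < 2 * (M * (N1 + N2)) + 1 by lra.
have eta0 : 0 < eta by rewrite lt_min ltr01 divr_gt0.
have eta1 : eta <= 1 by rewrite /eta ge_min lexx.
have eta2 : eta * (2 * (M * (N1 + N2)) + 1) <= e.
  by rewrite -ler_pdivlMr// /eta ge_min lexx orbT.
near=> s.
have ps : `|p s0 - p s| < eta by near: s; apply: cvgr_dist_lt => //; exact: pc.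
have ls : `|l s0 - l s| < eta by near: s; apply: cvgr_dist_lt => //; exact: lc.
have [WsD VsD] := WV s.
have [||||||] := HM (fun d x => W s d x - W s0 d x) (fun d x => V s d x - V s0 d x)
  (fun d x => ((q d x + p s) * (W s d x - W s0 d x) +
      coupling d * l s * (W s (~~ d) x - W s0 (~~ d) x)) +
    ((p s - p s0) * W s0 d x + coupling d * (l s - l s0) * W s0 (~~ d) x))
  (2 * eta * (N1 + N2)) _ _ _ _ _ _ c.
- by rewrite mulr_ge0 ?addr_ge0// mulr_ge0// ltW.
- by move=> d; rewrite !W0 subrr.
- by move=> d; rewrite !V0 subrr.
- by move=> d x _; have ? := WsD d x; have ? := WD d x; diff.
- by move=> d x _; have ? := VsD d x; have ? := VD d x; diff; ring.
- move=> d x xT.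
  apply: le_trans (ler_normD _ _) _; apply: lerD.
    apply: le_trans (@coupled_rhs_le q P (p s) (l s)
      (fun d x => W s d x - W s0 d x) x d qP) _.
    rewrite ler_wpM2r ?sumr_ge0//.
    have h1 : `|p s| <= `|p s0| + 1.
      have -> : p s = p s0 - (p s0 - p s) by ring.
      by apply: le_trans (ler_normB _ _) _; lra.
    have h2 : `|l s| <= `|l s0| + 1.
      have -> : l s = l s0 - (l s0 - l s) by ring.
      by apply: le_trans (ler_normB _ _) _; lra.
    by rewrite /B; lra.
  apply: le_trans (ler_normD _ _) _; rewrite !normrM normr_coupling mul1r.
  have h1 := HN d x xT; have h2 := HN (~~ d) x xT.
  rewrite distrC in ps; rewrite distrC in ls.
  have := ler_pM (normr_ge0 _) (normr_ge0 _) (ltW ps) h1.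
  have := ler_pM (normr_ge0 _) (normr_ge0 _) (ltW ls) h2.
  lra.
move=> _; rewrite distrC => h; apply: le_lt_trans h _.
apply: lt_le_trans eta2; rewrite -subr_gt0.
have -> : eta * (2 * (M * (N1 + N2)) + 1) - M * (2 * eta * (N1 + N2)) = eta by ring.
exact: eta0.
Unshelve. all: by end_near. Qed.

Definition unit_slope_ivp (r y dy : R -> R) : Prop :=
  [/\ forall x : R, is_derive x 1 y (dy x),
      forall x : R, is_derive x 1 dy (r x * y x), y 0 = 0 & dy 0 = 1].

Lemma unit_slope_unique (r y1 d1 y2 d2 : R -> R) P : (forall x, `|r x| <= P) ->
  unit_slope_ivp r y1 d1 -> unit_slope_ivp r y2 d2 -> forall x, 0 <= x -> d1 x = d2 x.
Proof.
move=> rP [y1D d1D y10 d10] [y2D d2D y20 d20] x x0.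
apply/eqP; rewrite -subr_eq0; apply/eqP.
have [||T T0|//] := @second_order_unique R unit (fun _ x => y1 x - y2 x)
  (fun _ x => d1 x - d2 x) (fun _ x => r x * y1 x - r x * y2 x) _ _ _ _ _ tt x x0.
- by rewrite y10 y20 subrr.
- by rewrite d10 d20 subrr.
exists P => [|_ y _]; first exact: le_trans (normr_ge0 _) (rP 0).
rewrite (bigD1 tt)//= big1 ?addr0; last by case.
by rewrite -mulrBr normrM ler_wpM2r.
Qed.

(** Without coupling the two components are independent, so the one with zero
    initial slope stays zero and the determinant of the shooting map is a
    product. *)
Lemma coupled0 q P p w v c : (forall c x, `|q c x| <= P) ->
  coupled q p 0 w v -> (forall d, w d 0 = 0) -> (forall d, v d 0 = (d == c)%:R) ->
  unit_slope_ivp (fun x => q c x + p) (w c) (v c) /\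
  forall x, 0 <= x -> v (~~ c) x = 0.
Proof.
move=> qP [wD vD] w0 v0; split.
  split => [//|x||]; rewrite ?w0 ?v0 ?eqxx//.
  by apply: is_derive_eq (vD c x) _; rewrite mulr0 mul0r addr0.
move=> x x0.
have [||y|T T0|//] := @second_order_unique R unit (fun _ => w (~~ c))
  (fun _ => v (~~ c)) (fun _ x => (q (~~ c) x + p) * w (~~ c) x)
  _ _ _ _ _ tt x x0.
- by rewrite w0.
- by rewrite v0; case: (c).
- by move=> x1; apply: is_derive_eq (vD _ x1) _; rewrite mulr0 mul0r addr0.
exists (P + `|p|) => [|_ y _]; first by rewrite addr_ge0// (le_trans (normr_ge0 _) (qP true 0)).
rewrite (bigD1 tt)//= big1 ?addr0; last by case.
rewrite normrM ler_wpM2r//; apply: le_trans (ler_normD _ _) _.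
by rewrite lerD2r.
Qed.

Lemma singular2_kernel (a b c d : R) : a * d - b * c = 0 ->
  exists s t, [/\ (s != 0) || (t != 0), a * s + b * t = 0 & c * s + d * t = 0].
Proof.
move=> det0; have [/andP[/eqP-> /eqP->]|ab] := boolP ((a == 0) && (b == 0)).
  have [/andP[/eqP-> /eqP->]|cd] := boolP ((c == 0) && (d == 0)).
    by exists 1, 0; rewrite oner_eq0; split => //; ring.
  exists (- d), c; rewrite oppr_eq0 -negb_and andbC; split => //; ring.
exists (- b), a; rewrite oppr_eq0 -negb_and andbC; split => //; first ring.
by rewrite -det0; ring.
Qed.

(** [q c + p] is the potential of component [c]. The hypotheses give the sign of
    the determinant at the two ends of the arc on which it must vanish. *)
Lemma shooting q P (p0 p1 m : R) :
  (forall c, continuous (q c)) -> (forall c x, `|q c x| <= P) ->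
  0 < p0 -> p0 < p1 -> 0 <= m ->
  (forall y dy : R -> R, unit_slope_ivp (fun x => q false x + p0) y dy -> dy m < 0) ->
  (forall y dy : R -> R, unit_slope_ivp (fun x => q true x + p0) y dy -> 0 < dy m) ->
  (forall c (y dy : R -> R), unit_slope_ivp (fun x => q c x + p1) y dy -> 0 < dy m) ->
  exists p l w v, [/\ 0 < p, 0 < l, coupled q p l w v, (forall c, w c 0 = 0) &
    (forall c, v c m = 0) /\ exists c, v c 0 != 0].
Proof.
move=> qc qP p00 p01 m0 neg pos0 pos1.
have /choice[S SP] : forall z : R * R * bool, exists wv,
    [/\ coupled q z.1.1 z.1.2 wv.1 wv.2, forall c, wv.1 c 0 = 0 &
        forall c, wv.2 c 0 = (c == z.2)%:R].
  by move=> z; exact: coupled_solution qc qP.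
(* this arc touches [l = 0] at its ends only *)
pose p s := p0 + s * (p1 - p0); pose l s : R := s * (1 - s).
pose W s b := (S (p s, l s, b)).1; pose V s b := (S (p s, l s, b)).2.
have WV s b : coupled q (p s) (l s) (W s b) (V s b) by have [] := SP (p s, l s, b).
have W0 s b c : W s b c 0 = 0 by have [_ H _] := SP (p s, l s, b); exact: H.
have V0 s b c : V s b c 0 = (c == b)%:R by have [_ _ H] := SP (p s, l s, b); exact: H.
have pc : continuous p.
  by move=> s; apply: (@is_derive_continuous _ _ _ (p1 - p0)); rewrite /p; diff; ring.
have lc : continuous l.
  by move=> s; apply: (@is_derive_continuous _ _ _ (1 - 2 * s)); rewrite /l; diff; ring.
have Vc b c : continuous (fun s => V s b c m).
  exact: (@coupled_continuous q P p l (fun c => (c == b)%:R)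
    (fun s => W s b) (fun s => V s b)).
pose det s := V s true true m * V s false false m
  - V s false true m * V s true false m.
have detc : continuous det.
  by move=> s; apply: cvgB; apply: cvgM; exact: Vc.
have ends s : l s = 0 -> det s = V s true true m * V s false false m /\
    forall b, unit_slope_ivp (fun x => q b x + p s) (W s b b) (V s b b).
  move=> ls0.
  have H b : unit_slope_ivp (fun x => q b x + p s) (W s b b) (V s b b) /\
      forall x, 0 <= x -> V s b (~~ b) x = 0.
    by apply: (coupled0 qP) => //; rewrite -ls0; exact: WV.
  split => [|b]; last by have [] := H b.
  by have [_ /(_ m m0)/= V1] := H true; rewrite /det V1 mulr0 subr0.
have l0 : l 0 = 0 by rewrite /l mul0r.
have l1 : l 1 = 0 by rewrite /l subrr mulr0.
have det0 : det 0 < 0.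
  have [-> H] := ends 0 l0; rewrite pmulr_rlt0.
    by apply: (neg (W 0 false false)); have := H false; rewrite /p mul0r addr0.
  by apply: (pos0 (W 0 true true)); have := H true; rewrite /p mul0r addr0.
have det1 : 0 < det 1.
  have p1E : p 1 = p1 by rewrite /p; ring.
  have [-> H] := ends 1 l1; rewrite p1E in H.
  by apply: mulr_gt0; [exact: pos1 (H true)|exact: pos1 (H false)].
have [||||s /andP[s0 s1] ds] := @continuous_zero R (fun s => - det s) 0 1.
- exact: ler01.
- by move=> s; apply: cvgN; exact: detc.
- by rewrite oppr_gt0.
- by rewrite oppr_le0 ltW.
have {}ds : det s = 0 by apply/eqP; rewrite -oppr_eq0 ds.
have {}s1 : s < 1.
  by rewrite lt_neqAle s1 andbT; apply: contraTneq det1 => <-; rewrite ds ltxx.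
have [a [b [ab eT eF]]] := singular2_kernel ds.
exists (p s), (l s), (fun c x => W s true c x * a + W s false c x * b),
  (fun c x => V s true c x * a + V s false c x * b); split.
- by rewrite /p ltr_wpDr//; apply: mulr_ge0; rewrite ?subr_ge0 ltW.
- by rewrite /l mulr_gt0// subr_gt0.
- have [WtD VtD] := WV s true; have [WfD VfD] := WV s false.
  split => c x.
    by have ? := WtD c x; have ? := WfD c x; diff; ring.
  by have ? := VtD c x; have ? := VfD c x; diff; ring.
- by move=> c; rewrite !W0 !mul0r addr0.
split; first by case; [exact: eT|exact: eF].
case/orP: ab => [a0|b0]; [exists true|exists false]; rewrite !V0 /=.
  by rewrite mul1r mul0r addr0.
by rewrite mul0r mul1r add0r.
Qed.

(** The sum [w x + w (- x)] and the difference [w (m + x) - w (m - x)] solve such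
    systems with zero initial data, so uniqueness gives [w] both symmetries; composing the two
    reflections twice is the translation by [4 * m]. *)
Lemma coupled_periodic q P p l w v (m : R) : (forall c x, `|q c x| <= P) ->
  (forall c x, q c (- x) = q c x) -> (forall c x, q c (m + x) = q c (m - x)) ->
  coupled q p l w v -> (forall c, w c 0 = 0) -> (forall c, v c m = 0) ->
  forall c x, w c (x + 4 * m) = w c x.
Proof.
move=> qP q_even q_sym [wD vD] w0 vm.
have w_odd c x : w c (- x) = - w c x.
  have H d y : 0 <= y -> w d y + w d (- y) = 0.
    apply: (@coupled_unique q P p l (fun d y => w d y + w d (- y))
      (fun d y => v d y - v d (- y))) => // [|e|e].
    - split => e z; first by diff; ring.
      by diff; rewrite q_even; ring.
    - by rewrite oppr0 w0 addr0.
    - by rewrite oppr0 subrr.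
  have [x0|x0] := leP 0 x; first by have := H c x x0; lra.
  by have := H c (- x); rewrite opprK oppr_ge0 ltW// => /(_ isT); lra.
have w_sym c x : w c (m + x) = w c (m - x).
  have H d y : 0 <= y -> w d (m + y) - w d (m - y) = 0.
    apply: (@coupled_unique (fun d y => q d (m + y)) P p l
      (fun d y => w d (m + y) - w d (m - y))
      (fun d y => v d (m + y) + v d (m - y))) => // [|e|e].
    - split => e z; first by diff; ring.
      by diff; rewrite q_sym; ring.
    - by rewrite subr0 addr0 subrr.
    - by rewrite subr0 addr0 vm addr0.
  have [x0|x0] := leP 0 x; first by have := H c x x0; lra.
  by have := H c (- x); rewrite opprK oppr_ge0 ltW// => /(_ isT); lra.
have w_half c x : w c (2 * m + x) = - w c x.
  have -> : 2 * m + x = m + (m + x) by ring.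
  by rewrite w_sym -w_odd; congr w; ring.
move=> c x; have -> : x + 4 * m = 2 * m + (2 * m + x) by ring.
by rewrite !w_half opprK.
Qed.

End coupled_system.

(** * Signs of the end slopes *)

Section slopes.
Context {R : realType}.
Variables (omega : R) (n : nat).
Hypotheses (n_gt0 : (0 < n)%N) (n_even : ~~ odd n).

(** Up to the constant p, the zeroth order term of L2 for [c = true] (which acts
    on the first component) and of L1 for [c = false]. *)
Definition potential (f : R -> R) (c : bool) (x : R) : R :=
  omega - (if c then 1 else n.+1%:R) * f x ^+ n.

Lemma exprN_even (a : R) : (- a) ^+ n = a ^+ n.
Proof. by rewrite exprNn -signr_odd (negPf n_even) expr0 mul1r. Qed.

Section positive_slope.
Context (L : R) (f g : R -> R).
Hypotheses (L_gt0 : 0 < L) (f_eq : profile_eq omega n f g) (f_odd : odd_fun f)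
  (f_per : minimal_period f L) (slope_gt0 : 0 < g 0).

Let m := L / 4.

Let m_gt0 : 0 < m. Proof. by rewrite divr_gt0. Qed.
Let fD (x : R) : is_derive x 1 f (g x) := f_eq.1 x.
Let gD (x : R) : is_derive x 1 g (omega * f x - f x ^+ n.+1) := f_eq.2 x.
Let g_gt0 x : 0 <= x < m -> 0 < g x.
Proof. exact: (profile_slope_gt0 n_even L_gt0 f_eq f_odd f_per). Qed.
Let f_gt0 x : 0 < x <= m -> 0 < f x.
Proof. exact: (profile_gt0 n_even L_gt0 f_eq f_odd f_per). Qed.
Let gm : g m = 0.
Proof. by have [] := profile_quarter n_even L_gt0 f_eq f_odd f_per. Qed.

Lemma potential_continuous c : continuous (potential f c).
Proof.
move=> x; apply: cvgB; first exact: cvg_cst.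
apply: cvgM; first exact: cvg_cst.
exact: is_derive_continuous (derive_ptX n (fD x)).
Qed.

Lemma profile_deriv2 (x : R) :
  is_derive x 1 (fun y => omega * f y - f y ^+ n.+1) (potential f false x * g x).
Proof. by have ? := fD x; diff; rewrite /potential /=; ring. Qed.

(** The derivative [g] of the profile is in the kernel of L1, and a supersolution
    for L2; it is positive on [0, m). *)
Lemma sturm_profile c (p : R) (y dy : R -> R) : 0 <= p ->
  unit_slope_ivp (fun x => potential f c x + p) y dy ->
  forall x, 0 < x < m -> 0 < y x.
Proof.
move=> p0 [yD dyD y0 dy0].
apply: (@sturm_positive R g (fun y => omega * f y - f y ^+ n.+1)
  (fun x => potential f false x * g x) y dy (fun x => potential f c x + p)) => //.
- exact: profile_deriv2.
- move=> x xm; apply: ler_wpM2r; first by rewrite ltW ?g_gt0.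
  have fn : 0 <= f x ^+ n by rewrite real_exprn_even_ge0 ?num_real.
  have n1 : 0 <= n%:R * f x ^+ n by rewrite mulr_ge0.
  by rewrite /potential -[n.+1%:R]natr1; case: (c) => /=; lra.
- by rewrite dy0.
Qed.

(** The Wronskian of [y] and [f] increases at the rate [p * y * f] and equals
    [dy m * f m] at [m]. *)
Lemma slope_true_gt0 (p : R) (y dy : R -> R) : 0 < p ->
  unit_slope_ivp (fun x => potential f true x + p) y dy -> 0 < dy m.
Proof.
move=> p0 Sy; have y_gt0 := sturm_profile (ltW p0) Sy.
have [yD dyD y0 dy0] := Sy.
have : dy 0 * f 0 - y 0 * g 0 < dy m * f m - y m * g m.
  apply: (@derive_gt0_lt _ (fun x => dy x * f x - y x * g x)
    (fun x => p * y x * f x)) => //.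
    move=> x _; have ? := yD x; have ? := dyD x; have ? := fD x; have ? := gD x.
    by diff; rewrite /potential exprS; ring.
  move=> x xm; rewrite !mulr_gt0 ?y_gt0 ?f_gt0//.
  by case/andP: xm => ->/ltW.
rewrite y0 (profile0 f_odd) gm !mulr0 mul0r !subr0 pmulr_lgt0//.
by rewrite f_gt0// m_gt0 lexx.
Qed.

(** The Wronskian of [y] and [f] is now driven by L1 f = - n f^(n+1) and equals
    [- dy m * f m] at [m]. *)
Lemma slope_false_lt0 (y dy : R -> R) :
  unit_slope_ivp (fun x => potential f false x + 0) y dy -> dy m < 0.
Proof.
move=> Sy; have y_gt0 := sturm_profile (lexx 0) Sy.
have [yD dyD y0 dy0] := Sy.
have : y 0 * g 0 - dy 0 * f 0 < y m * g m - dy m * f m.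
  apply: (@derive_gt0_lt _ (fun x => y x * g x - dy x * f x)
    (fun x => n%:R * f x ^+ n.+1 * y x)) => //.
    move=> x _; have ? := yD x; have ? := dyD x; have ? := fD x; have ? := gD x.
    by diff; rewrite /potential /= exprS -[n.+1%:R]natr1; ring.
  move=> x xm; rewrite !mulr_gt0 ?y_gt0 ?exprn_gt0 ?f_gt0 ?ltr0n//.
  by case/andP: xm => ->/ltW.
rewrite y0 (profile0 f_odd) gm !mulr0 mul0r !subr0 sub0r oppr_gt0 pmulr_llt0//.
by rewrite f_gt0// m_gt0 lexx.
Qed.

(** Constants are supersolutions, so [y] is positive and therefore convex. *)
Lemma slope_large_gt0 c (p : R) (y dy : R -> R) :
  (forall x, 0 <= potential f c x + p) ->
  unit_slope_ivp (fun x => potential f c x + p) y dy -> 0 < dy m.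
Proof.
move=> r_ge0 [yD dyD y0 dy0].
have y_gt0 : forall x, 0 < x < m -> 0 < y x.
  apply: (@sturm_positive R (fun=> 1) (fun=> 0) (fun=> 0) y dy
    (fun x => potential f c x + p)) => //.
  - by move=> x _; rewrite mulr1.
  - by rewrite dy0.
apply: (@lt_le_trans _ _ (dy 0)); first by rewrite dy0.
apply: (@derive_ge0_le _ dy (fun x => (potential f c x + p) * y x)) => //.
  exact: ltW.
by move=> x xm; rewrite mulr_ge0// ltW// y_gt0.
Qed.

Lemma potential_bounded :
  exists P, forall c x, `|potential f c x| <= P.
Proof.
have [P P0 fP] := profile_bounded L_gt0 f_eq f_odd f_per.
exists (`|omega| + n.+1%:R * P ^+ n) => c x.
apply: le_trans (ler_normB _ _) _; rewrite lerD2l normrM normrX.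
apply: ler_pM => //; first by case: c; rewrite ?normr1 ?normr_nat// ler1n.
by rewrite lerXn2r// nnegrE.
Qed.

(** Continuity in [p] at 0 of the end slope, which is that of a coupled solution
    with zero coupling. *)
Lemma small_slope_lt0 : exists2 p, 0 < p & forall y dy : R -> R,
  unit_slope_ivp (fun x => potential f false x + p) y dy -> dy m < 0.
Proof.
have [P qP] := potential_bounded.
have /choice[S SP] : forall p : R, exists wv,
    [/\ coupled (potential f) p 0 wv.1 wv.2, forall c, wv.1 c 0 = 0 &
        forall c, wv.2 c 0 = (c == false)%:R].
  by move=> p; exact: coupled_solution potential_continuous qP.
have Sy p : unit_slope_ivp (fun x => potential f false x + p)
    ((S p).1 false) ((S p).2 false).
  have [cS w0 v0] := SP p; by have [] := coupled0 qP cS w0 v0.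
have cont : continuous (fun p => (S p).2 false m).
  have cS p : coupled (potential f) p 0 (S p).1 (S p).2 by have [] := SP p.
  have W0 p c : (S p).1 c 0 = 0 by have [_ H _] := SP p; exact: H.
  have V0 p c : (S p).2 c 0 = (c == false)%:R by have [_ _ H] := SP p; exact: H.
  have lc : continuous (fun _ : R => 0 : R) by exact: cst_continuous.
  exact: (coupled_continuous qP (fun p => cvg_id) lc cS W0 V0 (ltW m_gt0)).
have S0 : (S 0).2 false m < 0 := slope_false_lt0 (Sy 0).
have : \forall p \near (0 : R), (S p).2 false m < 0.
  by apply: (cvgr_lt _ (cont 0)).
move=> /nbhs_ballP[e /= e0 He].
exists (e / 2) => [|y dy ySy]; first by rewrite divr_gt0.
have qpP x : `|potential f false x + e / 2| <= P + `|e / 2|.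
  by apply: le_trans (ler_normD _ _) _; rewrite lerD2r.
rewrite (unit_slope_unique qpP ySy (Sy _)) ?ltW//; apply: He.
by rewrite /ball/= sub0r normrN gtr0_norm; lra.
Qed.

Lemma unstable_mode_pos : exists p l w v,
  [/\ 0 < p, 0 < l, coupled (potential f) p l w v,
      (forall c, periodic (w c) L) & exists c, v c 0 != 0].
Proof.
have [P qP] := potential_bounded; have [p0 p00 neg] := small_slope_lt0.
have P0 : 0 <= P := le_trans (normr_ge0 _) (qP true 0).
have [|||||p [l [w [v [pp ll cwv w0 [vm v0]]]]]] :=
  @shooting R (potential f) P p0 (P + p0 + 1) m potential_continuous qP p00.
- by lra.
- exact: ltW.
- exact: neg.
- by move=> y dy; exact: slope_true_gt0.
- move=> c y dy; apply: slope_large_gt0 => x.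
  by have := qP c x; rewrite ler_norml => /andP[]; lra.
exists p, l, w, v; split => // c x.
have -> : L = 4 * m by rewrite /m; field.
apply: (coupled_periodic qP _ _ cwv w0 vm) => d y.
  by rewrite /potential f_odd exprN_even.
have [_ fs _] := profile_quarter n_even L_gt0 f_eq f_odd f_per.
by rewrite /potential fs.
Qed.

End positive_slope.

(** The potentials do not see the sign of [f], which may thus be chosen to make
    its slope at 0 positive. *)
Lemma unstable_mode (L : R) (f g : R -> R) : 0 < L -> profile_eq omega n f g ->
  odd_fun f -> minimal_period f L ->
  exists p l w v, [/\ 0 < p, 0 < l, coupled (potential f) p l w v,
      (forall c, periodic (w c) L) & exists c, v c 0 != 0].
Proof.
move=> L0 f_eq f_odd f_per.
have := profile_slope0 L0 f_eq f_odd f_per.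
rewrite neq_lt => /orP[g0|]; last exact: unstable_mode_pos.
have pE : potential f = potential (fun x => - f x).
  by apply/funext => c; apply/funext => x; rewrite /potential exprN_even.
rewrite pE; apply: (@unstable_mode_pos L (fun x => - f x) (fun x => - g x)) => //.
- have [fD gD] := f_eq; split => x; have ? := fD x; have ? := gD x; diff => //.
  by rewrite !exprS exprN_even; ring.
- by move=> x; rewrite f_odd.
- have [fL min] := f_per; split => [x|T T0 TL fT]; first by rewrite fL.
  by apply: (min T) => // x; apply/oppr_inj; exact: fT.
- by rewrite oppr_gt0.
Qed.

End slopes.

(** * Classical periodic functions as Sobolev functions *)

Section classical_periodic.
Context {R : realType}.
Notation mu := (@lebesgue_measure R).
Implicit Types (f F w v a : R -> R) (L : R).

Lemma L2per_continuous L f : periodic f L -> continuous f -> L2per L f.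
Proof.
move=> fL fc; split => //; first exact: continuous_measurable_fun.
have -> : (fun x => (f x ^+ 2)%:E) = EFin \o (fun x => f x ^+ 2) by [].
apply: continuous_compact_integrable; first exact: segment_compact.
by apply: continuous_subspaceT => x; rewrite /continuous_at !expr2; apply: cvgM; exact: fc.
Qed.

Lemma derivable_oo_LRcontinuousT F f (x y : R) :
  (forall x : R, is_derive x 1 F (f x)) -> derivable_oo_LRcontinuous F x y.
Proof.
move=> FD; have Fc z := is_derive_continuous (FD z).
split => [z _||]; first by have [] := FD z.
  exact/cvg_at_right_filter/Fc.
exact/cvg_at_left_filter/Fc.
Qed.

(** Integration by parts; the boundary terms cancel by periodicity. *)
Lemma weak_deriv_classical L F f : 0 < L -> periodic F L ->
  (forall x : R, is_derive x 1 F (f x)) -> continuous f -> weak_deriv L F f.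
Proof.
move=> L0 FL FD fc psi [psiL psi_smooth].
have psiD (x : R) : is_derive x 1 psi (derive1 psi x).
  by apply: DeriveDef; [exact: (psi_smooth 0%N x)|rewrite derive1E].
rewrite (@Rintegration_by_parts R F psi f (derive1 psi) 0 L)//.
- have := FL 0; have := psiL 0; rewrite add0r => -> ->.
  by rewrite subrr sub0r.
- exact: continuous_subspaceT.
- exact: derivable_oo_LRcontinuousT FD.
- by move=> x _; rewrite derive1E; have [_ ->] := FD x.
- apply: continuous_subspaceT => x.
  have /derivableP h := psi_smooth 1%N x; exact: is_derive_continuous h.
- exact: derivable_oo_LRcontinuousT psiD.
Qed.

Lemma periodic_derive L F f : periodic F L ->
  (forall x : R, is_derive x 1 F (f x)) -> periodic f L.
Proof.
move=> FL FD x.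
have h : is_derive x 1 (fun y => F (y + L)) (f (x + L)).
  by have ? := FD (x + L); diff; rewrite addr0 mulr1.
have FE : (fun y => F (y + L)) = F by apply/funext.
by rewrite FE in h; have [_ <-] := h; have [_ ->] := FD x.
Qed.

Lemma Hper2_classical L w v a : 0 < L ->
  periodic w L -> periodic v L -> periodic a L ->
  (forall x : R, is_derive x 1 w (v x)) ->
  (forall x : R, is_derive x 1 v (a x)) -> continuous a ->
  exists u : Hper L 2, [/\ wder u 0 = w, wder u 1 = v & wder u 2 = a].
Proof.
move=> L0 wL vL aL wD vD ac.
pose d i := match i with 0%N => w | 1%N => v | _ => a end.
have wc x := is_derive_continuous (wD x).
have vc x := is_derive_continuous (vD x).
have d_L2 i : (i <= 2)%N -> L2per L (d i).
  by case: i => [|[|i]] _ /=; apply: L2per_continuous.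
have d_weak i : (i < 2)%N -> weak_deriv L (d i) (d i.+1).
  by case: i => [|[|i]] // _ /=; apply: weak_deriv_classical.
by exists (MkHper d_L2 d_weak).
Qed.

(** Otherwise [f] would be nonzero on a ball, which has positive measure. *)
Lemma continuous_ae_eq0 f : continuous f -> ae_eq mu setT f (cst 0) -> f =1 cst 0.
Proof.
move=> fc f0 x; apply: contrapT => fx.
have : \forall y \near x, f y != 0.
  by apply: cvgr_neq0 (fc x) _; exact/eqP.
move=> /nbhs_ballP[e /= e0 He].
have [N [mN N0 HN]] := f0.
have : (mu (ball x e) <= mu N)%E.
  apply: le_measure; rewrite ?inE//; first exact: measurable_ball.
  move=> y ye; apply: HN => /= H; have /eqP := He y ye; apply; exact: H.
rewrite N0 lebesgue_measure_ball; last exact: ltW.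
by rewrite lee_fin leNgt pmulrn_lgt0 ?e0.
Qed.

End classical_periodic.

(** * Transverse instability *)

Theorem theorem1p2 (R : realType) (L omega : R) (alpha : nat)
    (L_gt0 : 0 < L) (omega_gt0 : 0 < omega)
    (alpha_gt0 : (0 < alpha)%N) (alpha_even : ~~ odd alpha)
    (phi : R -> R)
    (phi_odd : odd_fun phi)
    (phi_period : minimal_period phi L)
    (phi_sol : stationary_real omega alpha phi)
    (phi_min : obtained_from_minimization L omega alpha phi) :
  (exists (lambda kappa : R) (w : HHper L 2),
    [/\ 0 < lambda, 0 < kappa, ~ peq_ae (pair_of w) pzero &
        peq_ae (S_op omega alpha phi kappa w)
               (pscale lambda (J_op (pair_of w)))]) /\
  transversally_unstable L omega alpha phi.
Proof.
have absX (x : R) : `|x| ^+ alpha = x ^+ alpha.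
  by rewrite -normrX ger0_norm// real_exprn_even_ge0 ?num_real.
have [phiD phi_ode] := phi_sol.
have phi_eq : profile_eq omega alpha phi (derive1 phi).
  split => x; first by apply: DeriveDef; [have [] := phiD x|rewrite derive1E].
  apply: DeriveDef; first by have [] := phiD x.
  have := phi_ode x; rewrite absX derive1Sn derive1n1 -derive1E -exprSr => h.
  by lra.
have [p [l [w [v [p0 l0 [wD vD] w_per [c vc0]]]]]] :=
  unstable_mode alpha_gt0 alpha_even L_gt0 phi_eq phi_odd phi_period.
pose a c x := (potential omega alpha phi c x + p) * w c x
  + coupling c * l * w (~~ c) x.
have v_per d : periodic (v d) L := periodic_derive (w_per d) (wD d).
have a_per d : periodic (a d) L := periodic_derive (v_per d) (vD d).
have a_cont d : continuous (a d).
  have wc e : continuous (w e) by move=> x; exact: is_derive_continuous (wD e x).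
  move=> x; apply: cvgD; apply: cvgM; try exact: wc; last exact: cvg_cst.
  by apply: cvgD; [exact: potential_continuous phi_eq d x|exact: cvg_cst].
have mk d := Hper2_classical L_gt0 (w_per d) (v_per d) (a_per d) (wD d) (vD d)
  (a_cont d).
have [u1 [u10 _ u12]] := mk true; have [u2 [u20 _ u22]] := mk false.
have [z [z0 _ z2]] : exists z : Hper L 2,
    [/\ wder z 0 = cst 0, wder z 1 = cst 0 & wder z 2 = cst 0].
  apply: Hper2_classical => //; try (by move=> x; exact: is_derive_cst).
  exact: cst_continuous.
have k2 : Num.sqrt p ^+ 2 = p by rewrite sqr_sqrtr// ltW.
have S1 x : (S_op omega alpha phi (Num.sqrt p) (u1, u2)).1 x = - (l * w false x).
  rewrite /S_op /L2_op /Hper_fun /= u10 u12 k2 absX /a /potential /coupling /=; ring.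
have S2 x : (S_op omega alpha phi (Num.sqrt p) (u1, u2)).2 x = l * w true x.
  rewrite /S_op /L1_op /Hper_fun /= u20 u22 k2 absX /a /potential /coupling /=; ring.
have nz : ~ peq_ae (pair_of (u1, u2)) (@pzero R).
  rewrite /pair_of /Hper_fun /= u10 u20 => -[h1 h2].
  have wc0 : w c =1 cst 0.
    apply: continuous_ae_eq0; last by case: (c).
    by move=> x; exact: is_derive_continuous (wD c x).
  have /funext wE := wc0; have := wD c 0; rewrite wE => -[_ h].
  by move/eqP: vc0; apply; rewrite -h derive_cst.
have kappa0 : 0 < Num.sqrt p by rewrite sqrtr_gt0.
split.
  exists l, (Num.sqrt p), (u1, u2); split => //.
  split; apply: aeW => x _ /=.
    by rewrite -[LHS]/((S_op omega alpha phi (Num.sqrt p) (u1, u2)).1 x) S1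
      /pscale /J_op /= /Hper_fun u20 mulrN.
  by rewrite -[LHS]/((S_op omega alpha phi (Num.sqrt p) (u1, u2)).2 x) S2
    /pscale /J_op /= /Hper_fun u10.
exists (Num.sqrt p), (Complex l 0), (u1, u2), (z, z); split => //.
  by move=> [h _]; exact: nz.
have z00 x : (z : R -> R) x = 0 by rewrite /Hper_fun z0.
have Sz1 x : (S_op omega alpha phi (Num.sqrt p) (z, z)).1 x = 0.
  by rewrite /S_op /L2_op /= z2 z00 /= !mulr0 oppr0 !addr0.
have Sz2 x : (S_op omega alpha phi (Num.sqrt p) (z, z)).2 x = 0.
  by rewrite /S_op /L1_op /= z2 z00 /= !mulr0 oppr0 !addr0.
split; apply: aeW => x _.
  rewrite S1 Sz1 /J_op /= /Hper_fun u20 z0 /=.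
  by apply/eqP; rewrite eq_complex /= !mul0r !oppr0 !mulr0 !addr0 mulrN !eqxx.
rewrite S2 Sz2 /J_op /= /Hper_fun u10 z0 /=.
by apply/eqP; rewrite eq_complex /= !mul0r !mulr0 subr0 addr0 !eqxx.
Qed.
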